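(* Let $0<s<1$, $0<\beta<1$, and $L>0$. Consider the equation $$(-\Delta)^s u=f(u)\quad\text{in }\mathbb{R}.\qquad (\ast)$$ (i) If $2s\leq 1-\beta$, then there exists $u\in C^{\frac{2s}{1-\beta}}(\mathbb{R})$ which is $2L$-periodic, satisfies $(\ast)$ for some $f\in C^{\beta}(\mathbb{R})$, and such that $u\notin C^{\frac{2s}{1-\beta}+\epsilon}([-\rho,\rho])$ for every $\epsilon>0$ and every $\rho>0$. (ii) If $2s>1-\beta$, then there exists $u\in C^{2s+\beta}(\mathbb{R})$ which is $2L$-periodic, satisfies $(\ast)$ for some $f\in C^{\beta}(\mathbb{R})$, and such that $u\notin C^{2s+\beta+\epsilon}([-\rho,\rho])$ for every $\epsilon>0$ and every $\rho>0$.
   Context: The fractional Laplacian in dimension one is $$(-\Delta)^s u(x):=c_s\,\mathrm{P.V.}\!\int_{\mathbb{R}}\frac{u(x)-u(y)}{|x-y|^{1+2s}}\,dy,\qquad c_s:=\frac{s4^s\Gamma(1/2+s)}{\sqrt{\pi}\,\Gamma(1-s)},$$ where P.V. denotes the Cauchy principal value at $y=x$; it is well defined and finite at every point if $u\in C^\alpha(\mathbb{R})$ for some $\alpha>2s$. The equation $(-\Delta)^s u=f(u)$ in $\mathbb{R}$ means $(-\Delta)^s u(x)=f(u(x))$ for all $x\in\mathbb{R}$. Given $\Omega\subset\mathbb{R}$ and $\alpha\geq 0$, $C^\alpha(\Omega)$ denotes the space of functions on $\Omega$ that are continuously differentiable with bounded derivatives up to order $\lfloor\alpha\rfloor$ (continuous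 and bounded if $\lfloor\alpha\rfloor=0$) and whose $\lfloor\alpha\rfloor$-th derivatives satisfy the Hölder condition with index $\alpha-\lfloor\alpha\rfloor$, where $\lfloor\alpha\rfloor$ is the integer part of $\alpha$. In particular $C^\alpha(\Omega)\subset L^\infty(\Omega)$. *)

(* Defs.v *)
From mathcomp Require Import all_boot all_order all_algebra.
From mathcomp Require Import all_classical all_reals all_analysis.
Import Order.TTheory GRing.Theory Num.Theory.
Import numFieldNormedType.Exports.

Set Implicit Arguments.
Unset Strict Implicit.
Unset Printing Implicit Defensive.

Local Open Scope classical_set_scope.
Local Open Scope ring_scope.

(** * Hölder spaces C^alpha(Omega), for Omega a subset of R *)

(* A function on [Omega] is represented by a total function [R -> R], of which
   only the values on [Omega] matter. Difference quotients are taken inside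
   [Omega], so that on a closed interval the derivatives at the end points are
   one-sided. *)
Definition diff_quot (R : realType) (g : R -> R) (x y : R) : R :=
  (g y - g x) / (y - x).

Definition derivable_on (R : realType) (Omega : set R) (g : R -> R) : Prop :=
  forall x, Omega x -> cvg (diff_quot g x y @[y --> within Omega x^']).

Definition derive_on (R : realType) (Omega : set R) (g : R -> R) : R -> R :=
  fun x => lim (diff_quot g x y @[y --> within Omega x^']).

Definition deriven_on (R : realType) (Omega : set R) (n : nat) (g : R -> R) :
  R -> R := iter n (derive_on Omega) g.

(* For gamma = 0 this says that g has bounded oscillation, since 0 `^ 0 = 1. *)
Definition holder_on (R : realType) (Omega : set R) (gamma : R) (g : R -> R) :
  Prop :=
  exists C : R, forall x y, Omega x -> Omega y ->
    `|g x - g y| <= C * `|x - y| `^ gamma.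

Definition in_C (R : realType) (alpha : R) (Omega : set R) (u : R -> R) :
  Prop :=
  let k := Num.truncn alpha in
  [/\ forall i, (i < k)%N -> derivable_on Omega (deriven_on Omega i u),
      forall i, (i <= k)%N -> {within Omega, continuous (deriven_on Omega i u)},
      forall i, (i <= k)%N -> [bounded deriven_on Omega i u x | x in Omega]
    & holder_on Omega (alpha - k%:R) (deriven_on Omega k u)].

(** * The fractional Laplacian in dimension one *)

(* Euler's integral, meaningful for z > 0. *)
Definition Gamma (R : realType) (z : R) : R :=
  Rintegral lebesgue_measure `]0, +oo[%classic
    (fun t : R => t `^ (z - 1) * expR (- t)).

Definition c_fl (R : realType) (s : R) : R :=
  s * 4 `^ s * Gamma (1 / 2 + s) / (Num.sqrt pi * Gamma (1 - s)).

Definition fl_kernel (R : realType) (s : R) (u : R -> R) (x y : R) : R :=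
  (u x - u y) / `|x - y| `^ (1 + 2 * s).

Definition fl_dom (R : realType) (x e : R) : set R :=
  [set y | e < `|x - y|].

Definition fl_trunc (R : realType) (s : R) (u : R -> R) (x e : R) : R :=
  Rintegral lebesgue_measure (fl_dom x e) (fl_kernel s u x).

Definition frac_laplacian (R : realType) (s : R) (u : R -> R) (x : R) : R :=
  c_fl s * lim (fl_trunc s u x e @[e --> 0^'+]).

(* [Rintegral] and [lim] are total; the principal value is a genuine finite
   number only under the following condition. *)
Definition frac_laplacian_defined (R : realType) (s : R) (u : R -> R) (x : R) :
  Prop :=
  (forall e : R, 0 < e ->
     lebesgue_measure.-integrable (fl_dom x e) (EFin \o fl_kernel s u x)) /\
  cvg (fl_trunc s u x e @[e --> 0^'+]).

Definition solves_frac_eq (R : realType) (s : R) (u f : R -> R) : Prop :=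
  forall x, frac_laplacian_defined s u x /\ frac_laplacian s u x = f (u x).

(* Main.v *)
Require Import Defs.
From mathcomp Require Import all_boot all_order all_algebra.
From mathcomp Require Import all_classical all_reals all_analysis.
From mathcomp Require Import measurable_realfun.
From mathcomp Require Import ring lra zify.
Import Order.TTheory GRing.Theory Num.Theory.
Import numFieldNormedType.Exports.

(** The solution is an explicit sine series over the odd integers
    [n]. Put [w = pi / L], let [g] be the exponent claimed for [u], and
      [u x = sum_n n ^ (- 1 - g) * l n * sin (n w x)],
    where [l n = sum_j 4 ^ - j * n ^ (- m 2 ^ - j)] decays more slowly than any
    power of [n] and yet makes [sum_n l n / n] converge ([cvg_mix0]).

    Regularity. Convergence of [sum_n l n / n] gives [u] in [C^g] by estimating
    each mode separately. Conversely the coefficients are not [O(n ^ (-1-g-e))]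
    for any [e > 0]. At the origin the increments of a cosine series with
    nonnegative coefficients add up without cancellation, and on the scale
    [1 / n] they reveal the size of the coefficients ([scos_oscillation_ge]);
    a derivative or a primitive of [u] is such a series. So no exponent above
    [g] is possible in any neighbourhood of 0.

    The equation. On [sin (l x)] the fractional Laplacian acts as multiplication
    by a constant times [l ^ (2 s)] ([frac_laplacian_ssin]), so it maps [u] to a
    multiple of the series [v] of the same form with exponent [g - 2 s]. What
    has to be shown is that [v] is a Hölder function of [u] of order [beta]:
    McShane's extension then produces [f] ([hoelder_factor]). Here the odd
    frequencies matter. From
      [sum_n exp (- n t) sin (n x) / n = atan (sin x / sinh t) / 2]
    one gets, by a Mellin transform in [t] ([mellin_sineser]),
      [Gamma p * sum_n n ^ (- 1 - p) sin (n x)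
         = int_0^oo t ^ (p - 1) * atan (sin x / sinh t) / 2 dt],
    an increasing function of [sin x]. If [sin y <= sin x], the increments of
    the series between [y] and [x] for all exponents [p] are therefore Mellin
    transforms of a single profile [D >= 0], with [D <= pi / 2],
    [D t <= d / t], and [D >= c d] on [1, 2], where [d = sin x - sin y].

    If [2 s <= 1 - beta], then [D <= pi / 2] alone yields, on splitting the
    integral at a suitable [tau], an interpolation inequality
    [dv <= C * du ^ ((g - 2 s) / g)] between the increments of [v] and [u]
    ([ssin_mix_sub_interpolation]), and the exponent is [beta] when
    [g = 2 s / (1 - beta)]. If [2 s > 1 - beta], then [du >= c d] and
    [dv <= C * d ^ (g - 2 s)] ([ssin_mix_sub_lower], [ssin_mix_sub_holder]),
    and the exponent is [beta] when [g = 2 s + beta]. *)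

Local Open Scope classical_set_scope.
Local Open Scope ring_scope.

Set Implicit Arguments.
Unset Strict Implicit.
Unset Printing Implicit Defensive.

(** * Change of variables and power integrals *)

Section change_of_variables.
Context {R : realType}.
Local Notation mu := (@lebesgue_measure R).

Lemma ge0_integral_measure_preserving (phi : R -> R) (D : set R) (f : R -> \bar R) :
  measurable_fun [set: R] phi ->
  (forall A, measurable A -> mu (phi @^-1` A) = mu A) ->
  measurable D -> measurable_fun D f -> (forall x, 0 <= f x)%E ->
  (\int[mu]_(x in D) f x = \int[mu]_(x in phi @^-1` D) f (phi x))%E.
Proof.
move=> mphi muphi mD mf f0.
have mphi' : measurable_fun setT (phi : measurableTypeR R -> measurableTypeR R).
  exact: mphi.
rewrite -(ge0_integral_pushforward mphi' mu mD mf)//.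
by apply: eq_measure_integral => A mA AD; exact/esym/muphi.
Qed.

Lemma integral_measure_preserving (phi : R -> R) (D : set R) (f : R -> \bar R) :
  measurable_fun [set: R] phi ->
  (forall A, measurable A -> mu (phi @^-1` A) = mu A) ->
  measurable D -> measurable_fun D f ->
  (\int[mu]_(x in D) f x = \int[mu]_(x in phi @^-1` D) f (phi x))%E.
Proof.
move=> mphi muphi mD mf.
rewrite integralE [RHS]integralE; congr (_ - _)%E.
- rewrite (ge0_integral_measure_preserving mphi muphi mD (measurable_funepos mf)).
    by apply: eq_integral => x _; rewrite !funeposE.
  exact: funepos_ge0.
- rewrite (ge0_integral_measure_preserving mphi muphi mD (measurable_funeneg mf)).
    by apply: eq_integral => x _; rewrite !funenegE.
  exact: funeneg_ge0.
Qed.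

Lemma lebesgue_measure_shift (b : R) (A : set R) : measurable A ->
  mu ((fun x => b + x) @^-1` A) = mu A.
Proof.
move=> mA.
have mphi : measurable_fun setT (fun x : measurableTypeR R => b + x : measurableTypeR R).
  by apply: measurable_funD => //.
suff H : pushforward mu (fun x : measurableTypeR R => b + x : measurableTypeR R) A = mu A by exact: H.
apply/esym/lebesgue_measure_unique => //= _ [[c d]] _ <-.
rewrite /pushforward.
have -> : (fun x => b + x) @^-1` `]c, d] = `]c - b, d - b]%classic.
  by apply/seteqP; split => x /=; rewrite !in_itv/= ltrBlDl lerBrDl.
by rewrite !lebesgue_measure_itv/= !lte_fin ltrD2r; case: ifP => // _; rewrite -!EFinB; congr (_%:E); ring.
Qed.

Lemma lebesgue_measure_scale (a : R) (A : set R) : 0 < a -> measurable A ->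
  mu A = (a%:E * mu ((fun x => (a * x)%R) @^-1` A))%E.
Proof.
move=> a0 mA.
have mphi : measurable_fun setT (fun x : measurableTypeR R => a * x : measurableTypeR R).
  by apply: measurable_funM => //.
suff H : mu A = mscale (NngNum (ltW a0)) (pushforward mu (fun x : measurableTypeR R => a * x : measurableTypeR R)) A by exact: H.
move=> mphi'; apply: lebesgue_measure_unique => //= _ [[c d]] _ <-.
rewrite /mscale/= /pushforward.
have -> : (fun x => a * x) @^-1` `]c, d] = `]c / a, d / a]%classic.
  by apply/seteqP; split => x /=; rewrite !in_itv/= ltr_pdivrMr// ler_pdivlMr// ![_ * a]mulrC.
rewrite !lebesgue_measure_itv/= !lte_fin ltr_pM2r ?invr_gt0//; case: ifP => _.
  by rewrite -!EFinB -EFinM; congr (_%:E); field; rewrite gt_eqF.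
by rewrite mule0.
Qed.

Lemma ge0_integral_scale (a : R) (D : set R) (f : R -> \bar R) : 0 < a ->
  measurable D -> measurable_fun D f -> (forall x, D x -> 0 <= f x)%E ->
  (\int[mu]_(x in D) f x =
   a%:E * \int[mu]_(x in (fun x => (a * x)%R) @^-1` D) f (a * x)%R)%E.
Proof.
move=> a0 mD mf f0.
have mphi : measurable_fun setT (fun x : measurableTypeR R => a * x : measurableTypeR R).
  by apply: measurable_funM => //.
rewrite -(ge0_integral_pushforward mphi mu mD mf); last first.
  by move=> x /set_mem; exact: f0.
have -> : a%:E = (NngNum (ltW a0))%:num%:E by [].
rewrite -ge0_integral_mscale//.
apply: eq_measure_integral => A mA AD.
by rewrite /= /mscale/= /pushforward -lebesgue_measure_scale.
Qed.

End change_of_variables.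

Section power_integrals.
Context {R : realType}.
Local Notation mu := (@lebesgue_measure R).

Lemma continuous_powR (p x : R) : 0 < x -> {for x, continuous (fun t : R => t `^ p)}.
Proof.
move=> x0; apply: differentiable_continuous; apply/derivable1_diffP.
by have /(_ x0) [] := @is_derive1_powR R p x.
Qed.

Lemma integral_powR_segment (q a b : R) : q != 0 -> 0 < a -> a < b ->
  (\int[mu]_(x in `[a, b]) (x `^ (q - 1))%:E = ((b `^ q - a `^ q) / q)%:E)%E.
Proof.
move=> q0 a0 ab.
have b0 : 0 < b by exact: lt_trans ab.
have dF (x : R) : 0 < x -> is_derive x 1 (fun t : R => t `^ q / q) (x `^ (q - 1)).
  move=> x0; have dx := is_derive1_powR q x0.
  apply: is_derive_eq.
  by rewrite scaler0 add0r /GRing.scale/= mulrA mulVf// mul1r.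
have cF (x : R) : 0 < x -> {for x, continuous (fun t : R => t `^ q / q)}.
  move=> x0; apply: differentiable_continuous; apply/derivable1_diffP.
  by have [] := dF _ x0.
rewrite (@continuous_FTC2 _ _ (fun t : R => t `^ q / q))//.
- by rewrite -EFinB -mulrBl.
- apply: continuous_in_subspaceT => x; rewrite inE/= in_itv/= => /andP[ax _].
  by apply: continuous_powR; exact: lt_le_trans ax.
- split.
  + move=> x; rewrite in_itv/= => /andP[ax _].
    by have [] := dF _ (lt_trans a0 ax).
  + by apply: cvg_at_right_filter; exact: cF.
  + by apply: cvg_at_left_filter; exact: cF.
- move=> x; rewrite in_itv/= => /andP[ax _].
  by rewrite derive1E; have [_ ->] := dF _ (lt_trans a0 ax).
Qed.

(** The power is singular at 0 and its range may be unbounded, so the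
    fundamental theorem of calculus is applied on compact intervals and the
    bound passes to their union by monotone convergence. *)
Lemma integral_powR_bigcup_le (q M : R) (a b : nat -> R) : q != 0 ->
  (forall n, 0 < a n) -> (forall n, a n < b n) ->
  {homo a : m n / (m <= n)%N >-> n <= m} -> {homo b : m n / (m <= n)%N >-> m <= n} ->
  (forall n, (b n `^ q - a n `^ q) / q <= M) ->
  (\int[mu]_(x in \bigcup_n `[a n, b n]%classic) (x `^ (q - 1))%:E <= M%:E)%E.
Proof.
move=> q0 a0 ab nda ndb leM.
have mp D : measurable_fun D (EFin \o (fun x : R => x `^ (q - 1))).
  by apply/measurable_EFinP; apply: measurable_funTS; exact: measurable_powR.
have nd : {homo (fun n => `[a n, b n]%classic) : m n / (m <= n)%N >-> (m <= n)%O}.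
  move=> m n mn; apply/subsetPset => x/=; rewrite !in_itv/= => /andP[am bm].
  by rewrite (le_trans (nda _ _ mn) am)/= (le_trans bm (ndb _ _ mn)).
have cvgI := @ge0_nondecreasing_set_cvg_integral _ (measurableTypeR R) _ (fun n => `[a n, b n]%classic)
  (EFin \o (fun x : R => x `^ (q - 1))) mu nd (fun i => measurable_itv _)
  (fun i => mp _) (fun i x _ => powR_ge0 x (q - 1)).
rewrite -(cvg_lim _ cvgI)//; apply: lime_le; first by apply/cvg_ex; eexists; exact: cvgI.
by apply: nearW => n; rewrite integral_powR_segment// lee_fin.
Qed.

Lemma integral_powR0_le (q T : R) : 0 < q -> 0 < T ->
  (\int[mu]_(x in `]0%R, T]) (x `^ (q - 1))%:E <= (T `^ q / q)%:E)%E.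
Proof.
move=> q0 T0.
have -> : `]0, T]%classic = \bigcup_n `[T / n.+2%:R, T]%classic.
  apply/seteqP; split => x /=; rewrite ?in_itv/=.
    move=> /andP[x0 xT].
    exists (Num.truncn (T / x)) => //=; rewrite in_itv/= xT andbT.
    rewrite ler_pdivrMr// mulrC -ler_pdivrMr//.
    apply: ltW; apply: lt_trans (truncnS_gt _) _.
    by rewrite ltr_nat.
  move=> [n _] /=; rewrite in_itv/= => /andP[Tx ->]; rewrite andbT.
  by apply: lt_le_trans Tx; rewrite divr_gt0.
apply: integral_powR_bigcup_le => //; first by rewrite gt_eqF.
- by move=> n; rewrite divr_gt0.
- by move=> n; rewrite ltr_pdivrMr// ltr_pMr// ltr1n.
- by move=> m n mn; rewrite ler_pM2l// lef_pV2 ?posrE// ler_nat.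
- move=> n; rewrite ler_pM2r ?invr_gt0//.
  by rewrite gerBl powR_ge0.
Qed.

Lemma integral_powRy_le (q T : R) : 0 < q -> 0 < T ->
  (\int[mu]_(x in `[T, +oo[) (x `^ (- q - 1))%:E <= (T `^ (- q) / q)%:E)%E.
Proof.
move=> q0 T0.
have -> : `[T, +oo[%classic = \bigcup_n `[T, T + n.+1%:R]%classic.
  apply/seteqP; split => x /=; rewrite ?in_itv/= ?andbT.
    move=> Tx; exists (Num.truncn (x - T)) => //=; rewrite in_itv/= Tx/=.
    by rewrite -lerBlDl ltW// truncnS_gt.
  by move=> [n _] /=; rewrite in_itv/= => /andP[].
apply: integral_powR_bigcup_le => //; first by rewrite oppr_eq0 gt_eqF.
- by move=> n; rewrite ltrDl.
- by move=> m n mn; rewrite lerD2l ler_nat.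
- move=> n; rewrite invrN mulrN -mulNr opprB ler_pM2r ?invr_gt0//.
  by rewrite gerBl powR_ge0.
Qed.

Lemma ge0_integrable_le (D : set R) (f : R -> R) (M : R) :
  measurable D -> measurable_fun D f -> (forall x, D x -> 0 <= f x) ->
  (\int[mu]_(x in D) (f x)%:E <= M%:E)%E ->
  mu.-integrable D (EFin \o f) /\ \int[mu]_(x in D) f x <= M.
Proof.
move=> mD mf f0 fM.
have fi : mu.-integrable D (EFin \o f).
  apply/integrableP; split; first exact/measurable_EFinP.
  apply: le_lt_trans (ltry M); apply: le_trans fM.
  rewrite le_eqVlt; apply/orP; left; apply/eqP; apply: eq_integral => x /set_mem Dx /=.
  by rewrite ger0_norm// f0.
split=> //; rewrite /Rintegral -[leRHS]/(fine M%:E) fine_le//.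
exact: integrable_fin_num.
Qed.

Lemma integrable_setU (A B : set R) (f : R -> \bar R) :
  measurable A -> measurable B -> [disjoint A & B] ->
  mu.-integrable A f -> mu.-integrable B f -> mu.-integrable (A `|` B) f.
Proof.
move=> mA mB AB /integrableP[mfA fA] /integrableP[mfB fB].
have mf : measurable_fun (A `|` B) f by exact/measurable_funU.
apply/integrableP; split=> //.
rewrite ge0_integral_setU//; first exact: lte_add_pinfty.
exact: measurableT_comp.
Qed.

Lemma integrable_EFinD (A : set R) (f g : R -> R) : measurable A ->
  mu.-integrable A (EFin \o f) -> mu.-integrable A (EFin \o g) ->
  mu.-integrable A (EFin \o (fun x => f x + g x)).
Proof.
by move=> mA fi gi; apply: eq_integrable (integrableD _ fi gi).
Qed.

Lemma integrable_EFinZl (A : set R) (k : R) (f : R -> R) : measurable A ->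
  mu.-integrable A (EFin \o f) -> mu.-integrable A (EFin \o (fun x => k * f x)).
Proof.
by move=> mA fi; apply: eq_integrable (integrableZl _ k fi).
Qed.

Lemma powR_expR_le (p c : R) : 0 < c ->
  exists2 C : R, 0 <= C & forall t : R, 1 <= t -> t `^ p * expR (- (c * t)) <= C.
Proof.
move=> c0.
pose N := Num.truncn p.
have pN : p <= N.+1%:R by rewrite ltW// truncnS_gt.
exists (N.+1`!%:R / c ^+ N.+1); first by rewrite divr_ge0// exprn_ge0// ltW.
move=> t t1; have t0 : 0 < t by apply: lt_le_trans t1.
have : t `^ p <= t ^+ N.+1 by rewrite -powR_mulrn ?(ltW t0)// ler_powR.
rewrite expRN ler_pdivrMr ?expR_gt0// => /le_trans; apply.
have ct0 : 0 <= c * t by rewrite mulr_ge0// ltW.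
have := expR_ge1Dxn N ct0; rewrite exprMn => H.
have cN : 0 < c ^+ N.+1 by exact: exprn_gt0.
have fN : 0 < (N.+1)`!%:R :> R by rewrite ltr0n fact_gt0.
rewrite mulrAC ler_pdivlMr// mulrC [leRHS]mulrC -ler_pdivrMr//.
by apply: le_trans H; rewrite lerDr.
Qed.

(** The power alone is integrable near 0; at infinity the exponential absorbs
    [t ^ (p + 1)], which leaves [t ^ -2]. *)
Lemma integrable_powR_expR (p c : R) : 0 < p -> 0 < c ->
  mu.-integrable `]0, +oo[ (EFin \o (fun t => t `^ (p - 1) * expR (- (c * t)))).
Proof.
move=> p0 c0.
set f := fun t : R => _.
have mf D : measurable_fun D f.
  apply: measurable_funTS; apply: measurable_funM; first exact: measurable_powR.
  by apply: measurableT_comp => //; apply: measurableT_comp.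
have f0 (t : R) : 0 <= f t by rewrite mulr_ge0// ?powR_ge0// expR_ge0.
have -> : `]0, +oo[%classic = `]0, 1]%classic `|` `]1, +oo[%classic :> set R.
  apply/seteqP; split => x /=; rewrite !in_itv/= ?andbT.
    by move=> ->/=; case: (leP x 1) => H; [left|right].
  by move=> [/andP[]//|]; exact: lt_trans.
have [C C0 leC] := powR_expR_le (p + 1) c0.
have mpow (D : set R) q : measurable_fun D (fun x : R => (x `^ q)%:E).
  by apply/measurable_EFinP; apply: measurable_funTS; exact: measurable_powR.
apply: integrable_setU => //.
- by apply/disj_setPS => x [] /=; rewrite !in_itv/= andbT => /andP[_ /le_lt_trans h] /h; rewrite ltxx.
- have [] // := @ge0_integrable_le `]0, 1] f (1 `^ p / p).
  apply: le_trans (integral_powR0_le p0 ltr01); apply: ge0_le_integral => //.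
  + by move=> x _; rewrite lee_fin.
  + by apply/measurable_EFinP; exact: mf.
  + exact: mpow.
  + move=> x /=; rewrite in_itv/= => /andP[x0 _]; rewrite lee_fin.
    by rewrite ler_piMr ?powR_ge0// expR_le1 oppr_le0 mulr_ge0// ltW.
- have [] // := @ge0_integrable_le `]1, +oo[ f (C * (1 `^ (- 1) / 1)).
  apply: (@le_trans _ _ (\int[mu]_(x in `[1%R, +oo[) (C%:E * (x `^ (- 1 - 1))%:E))%E).
    rewrite -integral_itv_obnd_cbnd; last by apply: measurable_funeM; exact: mpow.
    apply: ge0_le_integral => //.
    + by move=> x _; rewrite lee_fin.
    + by apply/measurable_EFinP; exact: mf.
    + by apply: measurable_funeM; exact: mpow.
    + move=> x /=; rewrite in_itv/= andbT => x1; rewrite -EFinM lee_fin.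
      have x0 : 0 < x by exact: lt_trans x1.
      rewrite -[leLHS](_ : x `^ (p + 1) * expR (- (c * x)) * x `^ (-1 - 1) = _).
        by rewrite ler_pM2r ?powR_gt0// leC// ltW.
      rewrite mulrAC -powRD; last by rewrite (gt_eqF x0) implybT.
      by congr (_ `^ _ * _); ring.
  rewrite ge0_integralZl//; [|exact: mpow|by move=> x _; rewrite lee_fin powR_ge0].
  by rewrite EFinM lee_wpmul2l ?lee_fin// integral_powRy_le.
Qed.

End power_integrals.

(** * Mellin integrals on the half-line *)

Section mellin.
Context {R : realType}.
Local Notation mu := (@lebesgue_measure R).
Local Notation Dpos := (`]0, +oo[%classic : set R).

(** The substitution [t -> c t] in Euler's integral. *)
Lemma integral_powR_expR (p c : R) : 0 < p -> 0 < c ->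
  \int[mu]_(t in Dpos) (t `^ (p - 1) * expR (- (c * t))) = c `^ (- p) * Gamma p.
Proof.
move=> p0 c0.
have mf (D : set R) : measurable_fun D (fun t : R => (t `^ (p - 1) * expR (- t))%:E).
  apply/measurable_EFinP; apply: measurable_funTS; apply: measurable_funM; first exact: measurable_powR.
  by apply: measurableT_comp.
have E : (\int[mu]_(t in Dpos) (t `^ (p - 1) * expR (- t))%:E =
    c%:E * \int[mu]_(t in Dpos) (c `^ (p - 1) * (t `^ (p - 1) * expR (- (c * t))))%:E)%E.
  rewrite (@ge0_integral_scale _ c)//.
  - congr (_ * _)%E.
    have -> : (fun x => c * x) @^-1` Dpos = Dpos.
      by apply/seteqP; split => x /=; rewrite !in_itv/= !andbT pmulr_rgt0.
    apply: eq_integral => t; rewrite inE/= in_itv/= andbT => t0.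
    by rewrite powRM ?mulrA// ltW.
  - by move=> x _; rewrite lee_fin mulr_ge0// ?powR_ge0// expR_ge0.
have ip := integrable_powR_expR p0 c0.
rewrite /Gamma /Rintegral E.
under [in RHS]eq_integral do rewrite EFinM.
rewrite integralZl//.
have fin : (\int[mu]_(t in Dpos) (t `^ (p - 1) * expR (- (c * t)))%:E)%E \is a fin_num.
  exact: integrable_fin_num.
have [r Er] : exists r : R, (\int[mu]_(t in Dpos) (t `^ (p - 1) * expR (- (c * t)))%:E = r%:E)%E.
  by exists (fine (\int[mu]_(t in Dpos) (t `^ (p - 1) * expR (- (c * t)))%:E)%E); rewrite fineK.
rewrite !Er -!EFinM/= !mulrA powRN -(mulrA _ c).
by rewrite mulr_powRB1 ?(ltW c0)// mulVf ?mul1r// powR_eq0 gt_eqF.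
Qed.

Lemma Rintegral_ge_itv12 (f : R -> R) (c : R) :
  mu.-integrable Dpos (EFin \o f) -> 0 <= c ->
  (forall t : R, 0 < t -> 0 <= f t) -> (forall t, 1 <= t <= 2 -> c <= f t) ->
  c <= \int[mu]_(t in Dpos) f t.
Proof.
move=> fi c0 f0 fc.
have mf := measurable_int _ fi.
have sub : `[1%R, 2]%classic `<=` Dpos.
  by move=> t /=; rewrite !in_itv/= andbT => /andP[t1 _]; exact: lt_le_trans t1.
suff : (c%:E <= \int[mu]_(t in Dpos) (f t)%:E)%E.
  by move=> h; rewrite /Rintegral -[leLHS]/(fine c%:E) fine_le//; exact: integrable_fin_num.
apply: (@le_trans _ _ (\int[mu]_(t in `[1%R, 2%R]) (f t)%:E)%E); last first.
  apply: ge0_subset_integral => //.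
  by move=> t /=; rewrite in_itv/= andbT lee_fin => /f0.
apply: (@le_trans _ _ (\int[mu]_(t in `[1%R, 2%R]) (cst c%:E t))%E).
  rewrite integral_cst//= lebesgue_measure_itv/= lte_fin ltr1n.
  by rewrite -EFinB -EFinM lee_fin; lra.
apply: ge0_le_integral => //.
exact: measurable_funS mf.
Qed.

(** Already the part of Euler's integral over [1 <= t <= 2] is this large. The
    bound is the same for all [p], which is what summation over a family of
    exponents requires. *)
Lemma Gamma_lower (p : R) : 0 < p -> expR (- 2) / 2 <= Gamma p.
Proof.
move=> p0.
have ip := integrable_powR_expR p0 ltr01.
have -> : Gamma p = \int[mu]_(t in Dpos) (t `^ (p - 1) * expR (- (1 * t))).
  by rewrite integral_powR_expR// powR1 mul1r.
apply: Rintegral_ge_itv12 => //.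
- by move=> t t0; rewrite mulr_ge0// ?powR_ge0// expR_ge0.
- move=> t /andP[t1 t2].
  have t0 : 0 < t by exact: lt_le_trans t1.
  rewrite mulrC ler_pM ?expR_ge0//; last by rewrite mul1r ler_expR lerN2.
  apply: (@le_trans _ _ (t `^ (-1))).
    by rewrite powR_inv1 ?(ltW t0)// lef_pV2 ?posrE.
  by apply: ler_powR => //; lra.
Qed.

Lemma Gamma_gt0 (p : R) : 0 < p -> 0 < Gamma p.
Proof. by move=> p0; apply: lt_le_trans (Gamma_lower p0); rewrite divr_gt0// expR_gt0. Qed.

(** Pointwise, [t ^ e <= 1 + t ^ m]. Like the lower bound, this makes
    constants uniform over the exponents [p + e]. *)
Lemma Gamma_upper (p m e : R) : 0 < p -> 0 <= e <= m ->
  Gamma (p + e) <= Gamma p + Gamma (p + m).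
Proof.
move=> p0 /andP[e0 em].
have G (q : R) : 0 < q -> Gamma q = \int[mu]_(t in Dpos) (t `^ (q - 1) * expR (- (1 * t))).
  by move=> q0; rewrite integral_powR_expR// powR1 mul1r.
have pe : 0 < p + e by rewrite ltr_wpDr.
have pm : 0 < p + m by rewrite ltr_wpDr// (le_trans e0).
have i1 := integrable_powR_expR p0 ltr01.
have i2 := integrable_powR_expR pe ltr01.
have i3 := integrable_powR_expR pm ltr01.
rewrite !G// -RintegralD//; apply: le_Rintegral => //; first exact: integrable_EFinD.
move=> t /=; rewrite in_itv/= andbT => t0.
rewrite -mulrDl ler_wpM2r ?expR_ge0//.
have [t1|/ltW t1] := leP 1 t.
  apply: (@le_trans _ _ (t `^ (p + m - 1))); last by rewrite lerDr powR_ge0.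
  by apply: ler_powR => //; lra.
apply: (@le_trans _ _ (t `^ (p - 1))); last by rewrite lerDl powR_ge0.
by apply: ger_powR; rewrite ?t0//; lra.
Qed.

Section profile.
Variable D : R -> R.
Variable K : R.
Hypothesis D0 : forall t : R, 0 < t -> 0 <= D t.
Hypothesis DK : forall t : R, 0 < t -> D t <= K.
Hypothesis iD : forall p : R, 0 < p ->
  mu.-integrable Dpos (EFin \o (fun t => t `^ (p - 1) * D t)).
Local Notation J p := (\int[mu]_(t in Dpos) (t `^ (p - 1) * D t)).

Let integrand_ge0 (p t : R) : 0 < t -> 0 <= t `^ (p - 1) * D t.
Proof. by move=> t0; rewrite mulr_ge0 ?powR_ge0 ?D0. Qed.

(** Below [tau] the profile is replaced by its bound [K]. *)
Lemma mellin_split (p tau : R) : 0 < p -> 0 < tau ->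
  mu.-integrable `]tau, +oo[ (EFin \o (fun t => t `^ (p - 1) * D t)) /\
  \int[mu]_(t in `]tau, +oo[) (t `^ (p - 1) * D t) <= J p <=
  K * (tau `^ p / p) + \int[mu]_(t in `]tau, +oo[) (t `^ (p - 1) * D t).
Proof.
move=> p0 tau0.
have K0 : 0 <= K by apply: le_trans (D0 ltr01) (DK ltr01).
have U : Dpos = `]0, tau]%classic `|` `]tau, +oo[%classic.
  apply/seteqP; split => x /=; rewrite !in_itv/= ?andbT.
    by move=> ->/=; case: (leP x tau) => H; [left|right].
  by move=> [/andP[]//|]; exact: lt_trans.
have dis : [disjoint (`]0, tau]%classic : set R) & (`]tau, +oo[%classic : set R)].
  by apply/disj_setPS => x [] /=; rewrite !in_itv/= andbT => /andP[_ /le_lt_trans h] /h; rewrite ltxx.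
have i1 : mu.-integrable `]0, tau] (EFin \o (fun t => t `^ (p - 1) * D t)).
  apply: integrableS (iD p0) => //.
  by move=> x; rewrite /= !in_itv/= andbT => /andP[].
have i2 : mu.-integrable `]tau, +oo[ (EFin \o (fun t => t `^ (p - 1) * D t)).
  apply: integrableS (iD p0) => //.
  by move=> x; rewrite /= !in_itv/= !andbT; exact: lt_trans.
split=> //.
have mpow : measurable_fun `]0, tau] (fun x : R => K * x `^ (p - 1)).
  by apply: measurable_funM => //; apply: measurable_funTS; exact: measurable_powR.
have [i3 le3] : mu.-integrable `]0, tau] (EFin \o (fun t => K * t `^ (p - 1))) /\
   \int[mu]_(t in `]0, tau]) (K * t `^ (p - 1)) <= K * (tau `^ p / p).
  apply: ge0_integrable_le => //.
    by move=> x _; rewrite mulr_ge0// powR_ge0.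
  under eq_integral do rewrite EFinM.
  rewrite ge0_integralZl//; first by rewrite EFinM lee_wpmul2l ?lee_fin// integral_powR0_le.
  - by apply/measurable_EFinP; apply: measurable_funTS; exact: measurable_powR.
  - by move=> x _; rewrite lee_fin powR_ge0.
have E : J p = \int[mu]_(t in `]0, tau]) (t `^ (p - 1) * D t) +
   \int[mu]_(t in `]tau, +oo[) (t `^ (p - 1) * D t).
  by rewrite U Rintegral_setU// -U; exact: iD.
rewrite E lerDr lerD2r; apply/andP; split.
  by apply: Rintegral_ge0 => x /=; rewrite in_itv/= => /andP[x0 _]; exact: integrand_ge0.
apply: le_trans le3; apply: le_Rintegral => // x /=; rewrite in_itv/= => /andP[x0 _].
by rewrite mulrC ler_wpM2r ?powR_ge0// DK.
Qed.

(** Splitting at [tau] trades powers of [t]: below [tau] the profile is bounded,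
    above [tau] one has [t^(p'-p) <= tau^(p'-p)]. *)
Lemma mellin_interpolation (p' p tau : R) : 0 < p' -> p' <= p -> 0 < tau ->
  J p' <= K * (tau `^ p' / p') + tau `^ (p' - p) * J p.
Proof.
move=> p'0 p'p tau0.
have p0 : 0 < p by exact: lt_le_trans p'p.
have [i1 /andP[_ le1]] := mellin_split p'0 tau0.
have [i2 /andP[le2 _]] := mellin_split p0 tau0.
apply: le_trans le1 _; rewrite lerD2l.
apply: (@le_trans _ _ (tau `^ (p' - p) * \int[mu]_(t in `]tau, +oo[) (t `^ (p - 1) * D t))).
  rewrite -RintegralZl//; apply: le_Rintegral => //.
    exact: integrable_EFinZl.
  move=> t /=; rewrite in_itv/= andbT => taut.
  have t0 : 0 < t by exact: lt_trans taut.
  rewrite mulrA ler_wpM2r ?D0//.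
  have -> : p' - 1 = (p' - p) + (p - 1) by ring.
  rewrite powRD; last by rewrite (gt_eqF t0) implybT.
  rewrite ler_wpM2r ?powR_ge0//.
  have -> : p' - p = - (p - p') by ring.
  rewrite !powRN lef_pV2 ?posrE ?powR_gt0//.
  by apply: ge0_ler_powR; rewrite ?nnegrE ?subr_ge0// ltW.
by rewrite ler_wpM2l ?powR_ge0.
Qed.

(** The cut is made at [delta], where the two bounds [K] and [delta / t] on
    the profile are of the same size. *)
Lemma mellin_decay (p delta : R) : 0 < p -> p < 1 -> 0 < delta ->
  (forall t : R, 0 < t -> D t <= delta / t) ->
  J p <= (K / p + (1 - p)^-1) * delta `^ p.
Proof.
move=> p0 p1 d0 Dd.
have [i1 /andP[_ le1]] := mellin_split p0 d0.
apply: le_trans le1 _.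
have q0 : 0 < 1 - p by rewrite subr_gt0.
have mpow (A : set R) : measurable_fun A (fun x : R => delta * x `^ (- (1 - p) - 1)).
  by apply: measurable_funM => //; apply: measurable_funTS; exact: measurable_powR.
have mp (A : set R) : measurable_fun A (fun x : R => (x `^ (- (1 - p) - 1))%:E).
  by apply/measurable_EFinP; apply: measurable_funTS; exact: measurable_powR.
have [i3 le3] : mu.-integrable `]delta, +oo[ (EFin \o (fun t => delta * t `^ (- (1 - p) - 1))) /\
   \int[mu]_(t in `]delta, +oo[) (delta * t `^ (- (1 - p) - 1)) <= delta * (delta `^ (- (1 - p)) / (1 - p)).
  apply: ge0_integrable_le => //.
    by move=> x _; rewrite mulr_ge0 ?powR_ge0// ltW.
  under eq_integral do rewrite EFinM.
  rewrite ge0_integralZl ?lee_fin ?(ltW d0)//; last 2 first.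
  - exact: mp.
  - by move=> x _; rewrite lee_fin powR_ge0.
  rewrite EFinM lee_wpmul2l ?lee_fin ?(ltW d0)// integral_itv_obnd_cbnd; last exact: mp.
  exact: integral_powRy_le.
have dE : delta * (delta `^ (- (1 - p)) / (1 - p)) = (1 - p)^-1 * delta `^ p.
  rewrite mulrA mulrC; congr (_ * _).
  have -> : - (1 - p) = p - 1 by ring.
  by rewrite mulr_powRB1// ltW.
rewrite mulrDl -mulrA (mulrC _ (delta `^ p)) lerD2l -dE; apply: le_trans le3.
apply: le_Rintegral => // t /=; rewrite in_itv/= andbT => dt.
have t0 : 0 < t by exact: lt_trans dt.
apply: (@le_trans _ _ (t `^ (p - 1) * (delta / t))); first by rewrite ler_wpM2l ?powR_ge0// Dd.
rewrite mulrCA ler_wpM2l ?(ltW d0)//.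
have -> : - (1 - p) - 1 = p - 1 - 1 by ring.
by rewrite [leRHS]powRB ?powRr1 ?(ltW t0)// (gt_eqF t0) implybT.
Qed.

Lemma mellin_ge (p c : R) : 0 < p -> 0 <= c ->
  (forall t, 1 <= t <= 2 -> c <= D t) -> c / 2 <= J p.
Proof.
move=> p0 c0 Dc; apply: Rintegral_ge_itv12; [exact: iD| |exact: integrand_ge0|].
- by rewrite divr_ge0.
- move=> t t12; have /andP[t1 t2] := t12.
  have t0 : 0 < t by exact: lt_le_trans t1.
  rewrite mulrC; apply: ler_pM => //; last exact: Dc.
  apply: (@le_trans _ _ (t `^ (-1))).
    by rewrite powR_inv1 ?(ltW t0)// lef_pV2 ?posrE.
  by apply: ler_powR => //; lra.
Qed.

End profile.
End mellin.

(** * The odd sine series and its Mellin representation *)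

Section derivative_rules.
Context {R : realType}.
Implicit Types f : R -> R.

Lemma is_derive_cmul f (c x df : R) :
  is_derive x 1 f df -> is_derive x 1 (fun y => c * f y) (c * df).
Proof. exact: is_deriveZ. Qed.

Lemma is_derive_sum_nat (f : nat -> R -> R) (df : nat -> R) (x : R) N :
  (forall k, is_derive x 1 (f k) (df k)) ->
  is_derive x 1 (fun y => \sum_(0 <= k < N) f k y) (\sum_(0 <= k < N) df k).
Proof.
move=> fdf; elim: N => [|N IH].
  under eq_fun do rewrite big_nil.
  by rewrite big_nil; exact: is_derive_cst.
under eq_fun do rewrite big_nat_recr//=.
by rewrite big_nat_recr//=; exact: is_deriveD.
Qed.

Lemma is_derive_sin_scale (c x : R) :
  is_derive x 1 (fun y => sin (c * y)) (c * cos (c * x)).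
Proof.
have d1 : is_derive x 1 (fun y => c * y) (c * 1) by exact: is_derive_cmul.
have := is_derive1_comp (is_derive_sin (c * x)) d1.
by rewrite mulr1 mulrC.
Qed.

Lemma is_derive_cos_scale (c x : R) :
  is_derive x 1 (fun y => cos (c * y)) (- (c * sin (c * x))).
Proof.
have d1 : is_derive x 1 (fun y => c * y) (c * 1) by exact: is_derive_cmul.
have := is_derive1_comp (is_derive_cos (c * x)) d1.
by rewrite mulr1 mulrC mulrN.
Qed.

Lemma is_derive_continuous f (x df : R) : is_derive x 1 f df -> {for x, continuous f}.
Proof.
by move=> [fx _]; apply: differentiable_continuous; apply/derivable1_diffP.
Qed.

Lemma MVT_le f (df : R -> R) (M x y : R) :
  (forall z : R, is_derive z 1 f (df z)) -> (forall z : R, `|df z| <= M) ->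
  `|f x - f y| <= M * `|x - y|.
Proof.
move=> fdf dfM.
wlog xy : x y / x <= y.
  by move=> H; have [/H//|/ltW/H] := leP x y; rewrite distrC (distrC y).
have [|c _ E] := @MVT_segment R f df x y xy (fun z _ => fdf z).
- by apply: continuous_subspaceT => z; exact: is_derive_continuous (fdf z).
- by rewrite distrC E normrM distrC ler_wpM2r.
Qed.

Lemma sin_lipschitz (x y : R) : `|sin x - sin y| <= `|x - y|.
Proof.
rewrite -[leRHS]mul1r; apply: (@MVT_le sin cos) => z.
exact: cos_max.
Qed.

Lemma cos_lipschitz (x y : R) : `|cos x - cos y| <= `|x - y|.
Proof.
rewrite -[leRHS]mul1r; apply: (@MVT_le cos (fun z => - sin z)) => z.
by rewrite normrN sin_max.
Qed.

End derivative_rules.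

Section sine_series.
Context {R : realType}.
Local Notation mu := (@lebesgue_measure R).
Local Notation Dpos := (`]0, +oo[%classic : set R).

Definition oddn (k : nat) : R := k.*2.+1%:R.

Lemma oddn_ge1 k : 1 <= oddn k. Proof. by rewrite /oddn ler1n. Qed.
Lemma oddn_gt0 k : 0 < oddn k. Proof. by rewrite /oddn ltr0n. Qed.
Lemma oddnS k : oddn k.+1 = oddn k + 2.
Proof. by rewrite /oddn doubleS -addn2 natrD. Qed.

(** Bernoulli's inequality for [(1 - 2 / n) ^ (- p)], in place of a comparison
    with an integral. The factor [p^-1] governs how fast the sums blow up as
    [p] tends to 0. *)
Lemma oddn_powR_telescope (p : R) k : 0 < p ->
  oddn k.+1 `^ (- 1 - p) <= p^-1 * (oddn k `^ (- p) - oddn k.+1 `^ (- p)).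
Proof.
move=> p0.
have n0 := oddn_gt0 k; have m0 := oddn_gt0 k.+1.
have x0 : 0 < 2 / oddn k.+1 by rewrite divr_gt0.
have x1 : 2 / oddn k.+1 < 1 by rewrite ltr_pdivrMr// mul1r oddnS ltrDr.
have E : oddn k = oddn k.+1 * (1 - 2 / oddn k.+1).
  by rewrite mulrBr mulr1 mulrCA divff ?gt_eqF// mulr1 oddnS addrK.
have L : 1 + p * (2 / oddn k.+1) <= (1 - 2 / oddn k.+1) `^ (- p).
  rewrite /powR gt_eqF ?subr_gt0//.
  apply: le_trans (expR_ge1Dx _); rewrite lerD2l mulNr -mulrN ler_pM2l//.
  rewrite lerNr; apply: le_ln1Dx.
  by rewrite ltrNl opprK.
rewrite {1}E powRM ?(ltW m0) ?subr_ge0 ?(ltW x1)//.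
rewrite -[X in _ * _ - X]mulr1 -mulrBr ler_pdivlMl//.
have -> : -1 - p = - p - 1 by ring.
rewrite powRB; last by rewrite (gt_eqF m0) implybT.
rewrite powRr1 ?(ltW m0)// mulrCA ler_wpM2l ?powR_ge0// lerBrDl.
apply: le_trans L; rewrite lerD2l ler_wpM2l ?(ltW p0)//.
by rewrite ler_peMl ?invr_ge0 ?(ltW m0)// ler1n.
Qed.

Lemma sum_oddn_powR_le (p : R) N : 0 < p ->
  \sum_(0 <= k < N) oddn k `^ (- 1 - p) <= 1 + p^-1.
Proof.
move=> p0.
have [->|N0] := posnP N; first by rewrite big_nil addr_ge0// invr_ge0 ltW.
suff : \sum_(0 <= k < N) oddn k `^ (- 1 - p) <= 1 + p^-1 * (1 - oddn N.-1 `^ (- p)).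
  move=> /le_trans; apply; rewrite lerD2l ler_piMr ?invr_ge0 ?(ltW p0)//.
  by rewrite gerBl powR_ge0.
rewrite -(prednK N0) /=; elim: N.-1 => [|n IH].
  by rewrite big_nat1 /oddn /= !powR1 subrr mulr0 addr0.
rewrite big_nat_recr//=; apply: le_trans (lerD IH (oddn_powR_telescope n p0)) _.
by rewrite -addrA -mulrDr addrA subrK.
Qed.

Lemma cvg_series_oddn_powR (p : R) : 0 < p ->
  cvgn (series (fun k => oddn k `^ (- 1 - p))).
Proof.
move=> p0; apply: nondecreasing_is_cvgn.
  by apply: nondecreasing_series => k _ _; exact: powR_ge0.
by exists (1 + p^-1) => _ [N _ <-]; exact: sum_oddn_powR_le.
Qed.

Definition sineser (p x : R) : R :=
  limn (series (fun k => oddn k `^ (- 1 - p) * sin (oddn k * x))).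

Lemma cvg_sineser (p x : R) : 0 < p ->
  cvgn (series (fun k => oddn k `^ (- 1 - p) * sin (oddn k * x))).
Proof.
move=> p0; apply: normed_cvg.
apply: series_le_cvg (cvg_series_oddn_powR p0) => k.
- exact: normr_ge0.
- exact: powR_ge0.
- by rewrite /= normrM (ger0_norm (powR_ge0 _ _)) ler_piMr ?powR_ge0// sin_max.
Qed.

Definition sinhR (t : R) : R := (expR t - expR (- t)) / 2.

Lemma sinhR_ge (t : R) : 0 < t -> t / 2 <= sinhR t.
Proof.
move=> t0; rewrite /sinhR ler_pM2r ?invr_gt0//.
have := expR_ge1Dx t; have : expR (- t) <= 1 by rewrite expR_le1 oppr_le0 ltW.
lra.
Qed.

Lemma sinhR_gt0 (t : R) : 0 < t -> 0 < sinhR t.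
Proof. by move=> t0; apply: lt_le_trans (sinhR_ge t0); rewrite divr_gt0. Qed.

(** Closed form of the sum of [exp (- n t) sin (n x) / n] over the odd [n]. *)
Definition atan_kernel (x t : R) : R := atan (sin x / sinhR t) / 2.

(** The real part of a geometric sum with ratio [r ^ 2 exp (2 i x)],
    multiplied by [|1 - r ^ 2 exp (2 i x)| ^ 2]. *)
Lemma sum_geometric_cos (r x : R) N :
  (\sum_(0 <= k < N) r ^+ k.*2.+1 * cos (oddn k * x)) *
    ((1 - r ^+ 2) ^+ 2 + 4 * r ^+ 2 * sin x ^+ 2) =
  r * (1 - r ^+ 2) * cos x - r ^+ N.*2.+1 * cos (oddn N * x)
    + r ^+ N.*2.+3 * cos (oddn N * x - 2 * x).
Proof.
elim: N => [|N IH].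
  rewrite big_nil mul0r /oddn/= mul1r.
  have -> : x - 2 * x = - x by ring.
  by rewrite cosN; ring.
rewrite big_nat_recr//= mulrDl IH oddnS (mulrDl _ 2 x) addrK (cosD (oddn N * x) (2 * x)) cosB !doubleS.
have -> : cos (2 * x) = 1 - 2 * sin x ^+ 2.
  by rewrite mulr_natl cos_mulr2n cos2sin2; ring.
rewrite !exprS; ring.
Qed.

(** With [r = exp (- t)], [sinh t] is [(1 - r ^ 2) / (2 r)], and the
    derivative is the main term in [sum_geometric_cos] over the same
    denominator. *)
Lemma is_derive_atan_kernel (t x : R) : 0 < t ->
  let r := expR (- t) in
  is_derive x 1 (fun y => atan_kernel y t)
    (r * (1 - r ^+ 2) * cos x / ((1 - r ^+ 2) ^+ 2 + 4 * r ^+ 2 * sin x ^+ 2)).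
Proof.
move=> t0 r.
have r0 : 0 < r by exact: expR_gt0.
have r1 : r < 1 by rewrite /r expR_lt1 oppr_lt0.
have s0 := sinhR_gt0 t0.
have sE : sinhR t = (1 - r ^+ 2) / (2 * r).
  have Et : expR t = r^-1 by rewrite /r expRN invrK.
  by rewrite /sinhR Et -/r; field; rewrite gt_eqF.
have q0 : 0 < (1 - r ^+ 2) ^+ 2 + 4 * r ^+ 2 * sin x ^+ 2.
  rewrite ltr_wpDr//; first by rewrite mulr_ge0 ?sqr_ge0// mulr_ge0// sqr_ge0.
  by rewrite exprn_gt0// subr_gt0 expr_lt1// ltW.
have r2 : 0 < 1 - r ^+ 2 by rewrite subr_gt0 expr_lt1// ltW.
have d1 : is_derive x 1 (fun y => (sinhR t)^-1 * sin y) ((sinhR t)^-1 * cos x).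
  by apply: is_derive_cmul; exact: is_derive_sin.
have d2 := is_derive_cmul 2^-1 (@is_derive1_comp R atan (fun y => (sinhR t)^-1 * sin y) x _ _ (is_derive1_atan ((sinhR t)^-1 * sin x)) d1).
have -> : (fun y => atan_kernel y t) =
    (fun y => 2^-1 * (atan \o (fun y => (sinhR t)^-1 * sin y)) y).
  by apply/funext => y; rewrite /atan_kernel /= mulrC (mulrC (sin y)).
apply: is_derive_eq d2 _.
rewrite sE; field.
have a0 : 2 * r * sin x ^+ 2 * (2 * r) + (1 - r ^+ 2) ^+ 2 = (1 - r ^+ 2) ^+ 2 + 4 * r ^+ 2 * sin x ^+ 2.
  ring.
rewrite !gt_eqF//.
Qed.

(** The difference vanishes at [x = 0] and its derivative in [x] is the
    remainder of a geometric sum, so the mean value inequality bounds it. *)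
Lemma sum_atan_kernel_le (t x : R) N : 0 < t ->
  `|\sum_(0 <= k < N) (expR (- (oddn k * t)) / oddn k * sin (oddn k * x)) - atan_kernel x t|
  <= 2 / (1 - expR (- t) ^+ 2) ^+ 2 * `|x| * expR (- t) ^+ N.
Proof.
move=> t0; set r := expR (- t).
have r0 : 0 < r by exact: expR_gt0.
have r1 : r < 1 by rewrite /r expR_lt1 oppr_lt0.
have r2 : 0 < 1 - r ^+ 2 by rewrite subr_gt0 expr_lt1// ltW.
pose f y := \sum_(0 <= k < N) (expR (- (oddn k * t)) / oddn k * sin (oddn k * y)) - atan_kernel y t.
pose q y := (1 - r ^+ 2) ^+ 2 + 4 * r ^+ 2 * sin y ^+ 2.
have q0 y : (1 - r ^+ 2) ^+ 2 <= q y.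
  by rewrite lerDl mulr_ge0 ?sqr_ge0// mulr_ge0// sqr_ge0.
have q1 y : 0 < q y by apply: lt_le_trans (q0 y); rewrite exprn_gt0.
pose df y := (r ^+ N.*2.+3 * cos (oddn N * y - 2 * y) - r ^+ N.*2.+1 * cos (oddn N * y)) / q y.
have fdf (y : R) : is_derive y 1 f (df y).
  have H1 := is_derive_sum_nat N (fun k => is_derive_cmul
    (expR (- (oddn k * t)) / oddn k) (is_derive_sin_scale (oddn k) y)).
  have H2 := is_derive_atan_kernel y t0.
  apply: is_derive_eq (is_deriveB H1 H2) _.
  have S : \sum_(0 <= k < N) expR (- (oddn k * t)) / oddn k * (oddn k * cos (oddn k * y)) =
      (r * (1 - r ^+ 2) * cos y - r ^+ N.*2.+1 * cos (oddn N * y)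
        + r ^+ N.*2.+3 * cos (oddn N * y - 2 * y)) / q y.
    rewrite -sum_geometric_cos (mulfK (lt0r_neq0 (q1 y))); apply: eq_bigr => k _.
    rewrite mulrA divfK ?gt_eqF ?oddn_gt0//; congr (_ * _).
    by rewrite /r -expRM_natl mulrN.
  rewrite S -/r -/(q y) /df -mulrBl; congr (_ / _).
  by rewrite addrAC [X in X + _]addrAC subrr add0r addrC.
have f0 : f 0 = 0.
  rewrite /f /atan_kernel sin0 mul0r atan0 mul0r subr0 big1// => k _.
  by rewrite mulr0 sin0 mulr0.
suff : `|f x - f 0| <= 2 / (1 - r ^+ 2) ^+ 2 * r ^+ N * `|x - 0|.
  by rewrite f0 !subr0 mulrAC.
apply: (MVT_le _ _ fdf) => y.
rewrite /df normrM normfV (ger0_norm (ltW (q1 y))) [leRHS]mulrAC.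
apply: ler_pM => //; first by rewrite invr_ge0 ltW.
  have nc M z : (N <= M)%N -> `|r ^+ M * cos z| <= r ^+ N.
    move=> NM; rewrite normrM -[leRHS]mulr1; apply: ler_pM => //; last exact: cos_max.
    by rewrite ger0_norm ?exprn_ge0 ?ler_wiXn2l// ltW.
  apply: le_trans (ler_normB _ _) _.
  by rewrite (_ : 2 * r ^+ N = r ^+ N + r ^+ N) ?mulr_natl//; apply: lerD; apply: nc; rewrite -addnn; lia.
by rewrite lef_pV2 ?posrE// exprn_gt0.
Qed.

Lemma cvg_sum_atan_kernel (t x : R) : 0 < t ->
  (fun N => \sum_(0 <= k < N) (expR (- (oddn k * t)) / oddn k * sin (oddn k * x)))
    @ \oo --> atan_kernel x t.
Proof.
move=> t0; apply/subr_cvg0.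
have r1 : `|expR (- t)| < 1 by rewrite ger0_norm ?expR_ge0// expR_lt1 oppr_lt0.
set c := 2 / (1 - expR (- t) ^+ 2) ^+ 2 * `|x|.
apply: (@squeeze_cvgr _ _ _ _ (fun N => - (c * expR (- t) ^+ N)) (fun N => c * expR (- t) ^+ N)).
- by apply: nearW => N; rewrite -ler_norml; exact: sum_atan_kernel_le.
- by rewrite -oppr0 -(mulr0 c); apply: cvgN; apply: cvgMr; exact: cvg_expr.
- by rewrite -(mulr0 c); apply: cvgMr; exact: cvg_expr.
Qed.

(** One half of the exponential is spent on decay in [n], the other half keeps
    the decay in [t]. A small [h] makes the sum over [n] converge at the price
    of a singularity [t ^ (- h)] only. *)
Lemma expR_le_powR (t n h : R) : 0 < t -> 1 <= n -> 0 <= h <= 1 ->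
  expR (- (n * t)) <= n `^ (- h) * ((t / 2) `^ (- h) * expR (- (2^-1 * t))).
Proof.
move=> t0 n1 /andP[h0 h1].
have n0 : 0 < n by exact: lt_le_trans n1.
have y0 : 0 < n * (t / 2) by rewrite mulr_gt0// divr_gt0.
have -> : - (n * t) = - (n * (t / 2)) + - (n * (t / 2)).
  by rewrite -opprD -mulrDr -splitr.
rewrite expRD [leRHS]mulrA; apply: ler_pM; rewrite ?expR_ge0//; last first.
  by rewrite ler_expR lerN2 (mulrC 2^-1) ler_peMl// divr_ge0// ltW.
rewrite -powRM ?(ltW n0) ?divr_ge0 ?(ltW t0)//.
rewrite expRN powRN lef_pV2 ?posrE ?expR_gt0 ?powR_gt0//.
apply: (@le_trans _ _ (1 + n * (t / 2))); last exact: expR_ge1Dx.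
have [y1|/ltW y1] := leP 1 (n * (t / 2)).
  apply: (@le_trans _ _ ((n * (t / 2)) `^ 1)); first by apply: ler_powR.
  by rewrite powRr1 ?(ltW y0)// lerDr.
apply: (@le_trans _ _ ((n * (t / 2)) `^ 0)); first by apply: ger_powR; rewrite ?y0.
by rewrite powRr0 lerDl ltW.
Qed.

(** The series of [atan_kernel] is integrated term by term, each mode
    contributing [Gamma p / n ^ (1 + p)]. By [expR_le_powR] with [h < p] all
    partial sums have one integrable majorant. *)
Lemma mellin_sineser (p x : R) : 0 < p ->
  mu.-integrable Dpos (EFin \o (fun t => t `^ (p - 1) * atan_kernel x t)) /\
  \int[mu]_(t in Dpos) (t `^ (p - 1) * atan_kernel x t) = Gamma p * sineser p x.
Proof.
move=> p0.
pose h := Num.min (p / 2) 1.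
have h0 : 0 < h by rewrite lt_min divr_gt0// ltr01.
have h1 : h <= 1 by rewrite ge_min lexx orbT.
have hp : 0 < p - h.
  by rewrite subr_gt0; apply: (@le_lt_trans _ _ (p / 2)); [rewrite ge_min lexx|rewrite ltr_pdivrMr//; lra].
pose F N t := \sum_(0 <= k < N) (expR (- (oddn k * t)) / oddn k * sin (oddn k * x)).
pose c := 2 `^ h * (1 + h^-1).
pose g (t : R) := c * (t `^ (p - h - 1) * expR (- (2^-1 * t))).
have ig : mu.-integrable Dpos (EFin \o g).
  apply: integrable_EFinZl => //; apply: integrable_powR_expR => //.
have ie k : mu.-integrable Dpos (EFin \o (fun t => sin (oddn k * x) / oddn k * (t `^ (p - 1) * expR (- (oddn k * t))))).
  by apply: integrable_EFinZl => //; apply: integrable_powR_expR => //; exact: oddn_gt0.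
have FE N t : t `^ (p - 1) * F N t = \sum_(0 <= k < N) (sin (oddn k * x) / oddn k * (t `^ (p - 1) * expR (- (oddn k * t)))).
  by rewrite /F mulr_sumr; apply: eq_bigr => k _; ring.
have iF N : mu.-integrable Dpos (EFin \o (fun t => t `^ (p - 1) * F N t)) /\
   \int[mu]_(t in Dpos) (t `^ (p - 1) * F N t) =
   Gamma p * series (fun k => oddn k `^ (- 1 - p) * sin (oddn k * x)) N.
  elim: N => [|N [IH1 IH2]].
    split.
      rewrite (_ : (fun t => t `^ (p - 1) * F 0%N t) = cst 0); first exact: integrable0.
      by apply/funext => t; rewrite FE big_nil.
    under eq_Rintegral do rewrite FE big_nil.
    by rewrite /series/= big_nil mulr0 /Rintegral integral0.
  have E t : t `^ (p - 1) * F N.+1 t = t `^ (p - 1) * F N t + sin (oddn N * x) / oddn N * (t `^ (p - 1) * expR (- (oddn N * t))).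
    by rewrite !FE big_nat_recr.
  split.
    rewrite (_ : (fun t => t `^ (p - 1) * F N.+1 t) = fun t => t `^ (p - 1) * F N t + sin (oddn N * x) / oddn N * (t `^ (p - 1) * expR (- (oddn N * t)))).
      exact: integrable_EFinD.
    by apply/funext => t; exact: E.
  under eq_Rintegral do rewrite E.
  rewrite RintegralD// IH2 seriesSr/= mulrDr; congr (_ + _).
  rewrite RintegralZl//; last by apply: integrable_powR_expR => //; exact: oddn_gt0.
  rewrite integral_powR_expR ?oddn_gt0// powRB; last by rewrite (gt_eqF (oddn_gt0 _)) implybT.
  rewrite powR_inv1 ?(ltW (oddn_gt0 _))// powRN.
  by ring.
have Fle N t : 0 < t -> `|t `^ (p - 1) * F N t| <= g t.
  move=> t0; rewrite normrM ger0_norm ?powR_ge0//.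
  apply: (@le_trans _ _ (t `^ (p - 1) * ((t / 2) `^ (- h) * expR (- (2^-1 * t)) * (1 + h^-1)))).
    rewrite ler_wpM2l ?powR_ge0//.
    apply: le_trans (ler_norm_sum _ _ _) _.
    apply: le_trans (ler_wpM2l _ (sum_oddn_powR_le N h0)); last by rewrite mulr_ge0 ?powR_ge0 ?expR_ge0.
    rewrite mulr_sumr; apply: ler_sum => k _.
    have n0 := oddn_gt0 k.
    rewrite normrM -[leRHS]mulr1; apply: ler_pM => //; last exact: sin_max.
    rewrite ger0_norm ?divr_ge0 ?expR_ge0 ?(ltW n0)//.
    rewrite powRB; last by rewrite (gt_eqF n0) implybT.
    rewrite powR_inv1 ?(ltW n0)// mulrCA -powRN mulrC.
    rewrite ler_wpM2l ?invr_ge0 ?(ltW n0)// mulrC.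
    rewrite (mulrC t) [leRHS]mulrC; apply: expR_le_powR => //; first exact: oddn_ge1.
    by rewrite ltW.
  rewrite /g /c le_eqVlt; apply/orP; left; apply/eqP.
  have -> : p - h - 1 = p - 1 + - h by ring.
  rewrite (@powRD _ t (p - 1) (- h)); last by rewrite (gt_eqF t0) implybT.
  rewrite powRM ?invr_ge0 ?(ltW t0)//.
  have -> : 2^-1 `^ (- h) = 2 `^ h.
    by rewrite -(powR_inv1 (ler0n _ 2)) -powRrM mulN1r opprK.
  by ring.
have cvgF t : 0 < t -> t `^ (p - 1) * F N t @[N --> \oo] --> t `^ (p - 1) * atan_kernel x t.
  by move=> t0; apply: cvgMr; exact: cvg_sum_atan_kernel.
have mF N : measurable_fun Dpos (fun t => t `^ (p - 1) * F N t).
  by apply/measurable_EFinP; exact: (measurable_int _ (iF N).1).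
have mA : measurable_fun Dpos (fun t => t `^ (p - 1) * atan_kernel x t).
  apply: (measurable_fun_cvg mF) => t /=; rewrite in_itv/= andbT; exact: cvgF.
have [] := @dominated_convergence _ (measurableTypeR R) R mu Dpos (measurable_itv _)
  (fun N => EFin \o (fun t => t `^ (p - 1) * F N t)) (EFin \o (fun t => t `^ (p - 1) * atan_kernel x t))
  (EFin \o g).
- by move=> N; exact: (measurable_int _ (iF N).1).
- exact/measurable_EFinP.
- apply: aeW => t /=; rewrite in_itv/= andbT => t0.
  by apply: cvg_EFin; [exact: nearW|exact: cvgF].
- exact: ig.
- by apply: aeW => t N /=; rewrite in_itv/= andbT => t0; rewrite lee_fin; exact: Fle.
move=> iA _ cvgI; split=> //.
have fin : (\int[mu]_(t in Dpos) (t `^ (p - 1) * atan_kernel x t)%:E)%E \is a fin_num.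
  exact: integrable_fin_num.
have : (fun N => \int[mu]_(t in Dpos) (t `^ (p - 1) * F N t)) @ \oo -->
    \int[mu]_(t in Dpos) (t `^ (p - 1) * atan_kernel x t).
  by apply: fine_cvg; rewrite fineK.
under eq_fun do rewrite (iF _).2.
move=> /cvg_lim <-//; apply/cvg_lim => //; apply: cvgMr; exact: cvg_sineser.
Qed.

End sine_series.

Section comparison.
Context {R : realType}.
Local Notation mu := (@lebesgue_measure R).
Local Notation Dpos := (`]0, +oo[%classic : set R).
Variables (x y : R).
Hypothesis yx : sin y <= sin x.
Local Notation dker t := (atan_kernel x t - atan_kernel y t).

Let le_quot (t : R) : 0 < t -> sin y / sinhR t <= sin x / sinhR t.
Proof. by move=> t0; rewrite ler_pM2r// invr_gt0 sinhR_gt0. Qed.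

(** The kernel depends on [x] through [sin x] only, and increasingly. Hence
    the increments of all the series [sineser p] between [y] and [x] are
    Mellin transforms of one nonnegative profile, which makes them comparable
    with each other. *)
Lemma dker_ge0 t : 0 < t -> 0 <= dker t.
Proof. by move=> t0; rewrite subr_ge0 ler_pM2r// le_atan// le_quot. Qed.

Lemma dker_le t : 0 < t -> dker t <= pi / 2.
Proof.
move=> t0; rewrite /atan_kernel -mulrBl ler_pM2r//.
have := atan_ltpi2 (sin x / sinhR t); have := atan_gtNpi2 (sin y / sinhR t); lra.
Qed.

Let dker_MVT (t : R) : 0 < t -> exists2 c : R,
  sin y / sinhR t <= c <= sin x / sinhR t &
  dker t = (1 + c ^+ 2)^-1 * ((sin x - sin y) / sinhR t) / 2.
Proof.
move=> t0.
have [|c cxy E] := @MVT_segment R atan (fun z => (1 + z ^+ 2)^-1) _ _ (le_quot t0)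
  (fun z _ => is_derive1_atan z).
  by apply: continuous_subspaceT => z; exact: continuous_atan.
exists c; first by move: cxy; rewrite in_itv.
by rewrite /atan_kernel -mulrBl E -mulrBl.
Qed.

Lemma dker_decay t : 0 < t -> dker t <= (sin x - sin y) / t.
Proof.
move=> t0; have [c _ ->] := dker_MVT t0.
have d0 : 0 <= sin x - sin y by rewrite subr_ge0.
have s0 := sinhR_gt0 t0.
apply: (@le_trans _ _ ((sin x - sin y) / sinhR t / 2)).
  rewrite ler_pM2r// ler_piMl//; first by rewrite divr_ge0// ltW.
  by rewrite invf_le1 ?lerDl ?sqr_ge0// ltr_wpDr// sqr_ge0.
rewrite -mulrA ler_wpM2l// -invfM lef_pV2 ?posrE ?(mulr_gt0 s0)//.
by have := sinhR_ge t0; lra.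
Qed.

(** For these [t] one has [sinh t >= 1 / 2], so the arguments of the
    arctangent stay in [-2, 2], where its derivative is at least [1 / 5]; and
    [sinh t <= exp 2 / 2]. *)
Lemma dker_lower t : 1 <= t <= 2 -> expR (- 2) / 5 * (sin x - sin y) <= dker t.
Proof.
move=> /andP[t1 t2]; have t0 : 0 < t by exact: lt_le_trans t1.
have [c /andP[cy cx] ->] := dker_MVT t0.
have d0 : 0 <= sin x - sin y by rewrite subr_ge0.
have s0 := sinhR_gt0 t0.
have s1 : 2^-1 <= sinhR t by apply: le_trans (sinhR_ge t0); rewrite ler_pdivlMr// mulVf.
have s2 : sinhR t <= expR 2 / 2.
  rewrite ler_pM2r// -[leRHS]subr0; apply: lerB; first by rewrite ler_expR.
  exact: expR_ge0.
have sV : (sinhR t)^-1 <= 2 by rewrite -[leRHS]invrK lef_pV2 ?posrE.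
have c2 : c ^+ 2 <= 4.
  have : `|c| <= 2.
    rewrite ler_norml; apply/andP; split.
      apply: le_trans cy; rewrite -mulN1r; apply: (@le_trans _ _ (- 1 * (sinhR t)^-1)).
        by rewrite !mulN1r lerN2.
      by rewrite ler_pM2r ?invr_gt0// sin_geN1.
    apply: le_trans cx _; apply: le_trans sV.
    by rewrite ler_piMl ?invr_ge0 ?(ltW s0)// sin_le1.
  by rewrite -[c ^+ 2]real_normK ?num_real// => c2; rewrite -[leRHS](_ : 2 ^+ 2 = 4) ?ler_sqr ?nnegrE//; ring.
have -> : (1 + c ^+ 2)^-1 * ((sin x - sin y) / sinhR t) / 2 =
   ((1 + c ^+ 2)^-1 * ((sinhR t)^-1 / 2)) * (sin x - sin y) by ring.
rewrite ler_wpM2r// mulrC; apply: ler_pM; rewrite ?expR_ge0//.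
  rewrite lef_pV2 ?posrE//; last by rewrite ltr_wpDr// sqr_ge0.
  lra.
have h : sinhR t * 2 <= expR 2 by rewrite -ler_pdivlMr.
by rewrite expRN -invfM lef_pV2// posrE ?expR_gt0// mulr_gt0.
Qed.

Lemma integrable_dker p : 0 < p -> mu.-integrable Dpos (EFin \o (fun t => t `^ (p - 1) * dker t)).
Proof.
move=> p0; have [i1 _] := mellin_sineser x p0; have [i2 _] := mellin_sineser y p0.
have -> : (fun t => t `^ (p - 1) * dker t) =
  (fun t => t `^ (p - 1) * atan_kernel x t + (- 1) * (t `^ (p - 1) * atan_kernel y t)).
  by apply/funext => t; ring.
by apply: integrable_EFinD => //; exact: integrable_EFinZl.
Qed.

Lemma mellin_dker p : 0 < p ->
  \int[mu]_(t in Dpos) (t `^ (p - 1) * dker t) = Gamma p * (sineser p x - sineser p y).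
Proof.
move=> p0; have [i1 e1] := mellin_sineser x p0; have [i2 e2] := mellin_sineser y p0.
rewrite mulrBr -e1 -e2 -RintegralB//.
by apply: eq_Rintegral => t _; rewrite mulrBr.
Qed.

Lemma sineser_interpolation (p' p tau : R) : 0 < p' -> p' <= p -> 0 < tau ->
  Gamma p' * (sineser p' x - sineser p' y) <=
  pi / 2 * (tau `^ p' / p') + tau `^ (p' - p) * (Gamma p * (sineser p x - sineser p y)).
Proof.
move=> p'0 p'p tau0; have p0 := lt_le_trans p'0 p'p.
rewrite -!mellin_dker//.
exact: (mellin_interpolation dker_ge0 dker_le integrable_dker).
Qed.

Lemma sineser_holder (p : R) : 0 < p -> p < 1 ->
  Gamma p * (sineser p x - sineser p y) <=
  (pi / 2 / p + (1 - p)^-1) * (sin x - sin y) `^ p.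
Proof.
move=> p0 p1; rewrite -mellin_dker//.
have [xy|/negP xy] := eqVneq (sin x) (sin y).
  rewrite xy subrr powR0 ?gt_eqF// mulr0.
  rewrite le_eqVlt; apply/orP; left; apply/eqP.
  under eq_Rintegral do rewrite /atan_kernel xy subrr mulr0.
  by rewrite /Rintegral integral0.
apply: (mellin_decay dker_ge0 dker_le integrable_dker) => //; last exact: dker_decay.
by rewrite subr_gt0 lt_neqAle yx eq_sym andbT; apply/negP.
Qed.

Lemma sineser_lower (p : R) : 0 < p ->
  expR (- 2) / 10 * (sin x - sin y) <= Gamma p * (sineser p x - sineser p y).
Proof.
move=> p0; rewrite -mellin_dker//.
have -> : expR (- 2) / 10 * (sin x - sin y) = expR (- 2) / 5 * (sin x - sin y) / 2.
  by field.
apply: (mellin_ge dker_ge0 integrable_dker) => //; last exact: dker_lower.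
by rewrite mulr_ge0 ?subr_ge0// divr_ge0// expR_ge0.
Qed.

Lemma sineser_mono (p : R) : 0 < p -> sineser p y <= sineser p x.
Proof.
move=> p0; rewrite -subr_ge0 -(pmulr_rge0 _ (Gamma_gt0 p0)).
apply: le_trans (sineser_lower p0).
by rewrite mulr_ge0 ?subr_ge0// divr_ge0// expR_ge0.
Qed.

End comparison.

(** * Dominated series *)

Section dominated_series.
Context {R : realType}.
Implicit Types (f g M : nat -> R).

Lemma cvg_series_cmul (c : R) f :
  cvgn (series f) -> cvgn (series (fun k => c * f k)).
Proof. by move=> cf; have := @is_cvg_seriesZ R f c cf. Qed.

Lemma lim_series_cmul (c : R) f : cvgn (series f) ->
  limn (series (fun k => c * f k)) = c * limn (series f).
Proof. by move=> cf; have := @lim_seriesZ R f c cf. Qed.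

Lemma dominated_series_cvg f M : (forall k, `|f k| <= M k) ->
  cvgn (series M) -> cvgn (series f).
Proof.
move=> fM cM; apply: normed_cvg; apply: series_le_cvg cM => k //=.
exact: le_trans (fM k).
Qed.

Lemma dominated_series_tail f M N : (forall k, `|f k| <= M k) ->
  cvgn (series M) ->
  `|limn (series f) - series f N| <= limn (series M) - series M N.
Proof.
move=> fM cM.
have cf := dominated_series_cvg fM cM.
have M0 k : 0 <= M k by exact: le_trans (fM k).
have cd : (fun n => `|series f n - series f N|) @ \oo --> `|limn (series f) - series f N|.
  by apply: cvg_norm; apply: cvgB => //; exact: cvg_cst.
rewrite -(cvg_lim _ cd)//; apply: limr_le; first by apply/cvg_ex; eexists; exact: cd.
near=> n.
have Nn : (N <= n)%N by near: n; exact: nbhs_infty_ge.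
rewrite sub_series_geq//; apply: le_trans (ler_norm_sum _ _ _) _.
apply: (@le_trans _ _ (series M n - series M N)).
  by rewrite sub_series_geq//; apply: ler_sum => k _.
rewrite lerD2r; apply: nondecreasing_cvgn_le => //.
by apply: nondecreasing_series => k _ _.
Unshelve. all: by end_near. Qed.

Lemma dominated_series_le f M : (forall k, `|f k| <= M k) ->
  cvgn (series M) -> `|limn (series f)| <= limn (series M).
Proof.
move=> fM cM; have := dominated_series_tail 0 fM cM.
by rewrite /series/= !big_geq// !subr0.
Qed.

Lemma ge0_series_lim_ge f N : (forall k, 0 <= f k) -> cvgn (series f) ->
  series f N <= limn (series f).
Proof.
move=> f0 cf; apply: nondecreasing_cvgn_le => //.
by apply: nondecreasing_series => k _ _.
Qed.

(** Tannery's theorem: a uniform summable majorant allows passing to the limit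
    term by term. *)
Lemma tannery {T : Type} (F : set_system T) {FF : ProperFilter F}
    (f : nat -> T -> R) (l M : nat -> R) :
  cvgn (series M) -> (\forall t \near F, forall k, `|f k t| <= M k) ->
  (forall k, f k @ F --> l k) ->
  (fun t => limn (series (f^~ t))) @ F --> limn (series l).
Proof.
move=> cM fM fl.
have lM k : `|l k| <= M k.
  have cn : (fun t => `|f k t|) @ F --> `|l k| by exact: cvg_norm.
  rewrite -(cvg_lim _ cn)//; apply: limr_le; first by apply/cvg_ex; eexists; exact: cn.
  by apply: filterS fM => t; exact.
apply/cvgrPdist_lt => e e0.
have e4 : 0 < e / 4 by rewrite divr_gt0.
have [N tailN] : exists N, limn (series M) - series M N < e / 4.
  have /cvgrPdist_lt/(_ _ e4) [N _ /(_ N (leqnn N))] := cM.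
  by move=> /(le_lt_trans (ler_norm _)); exists N.
have cN : (fun t => series (f^~ t) N) @ F --> series l N.
  rewrite /series/=; elim: N {tailN} => [|N IH].
    by under eq_fun do rewrite big_geq//; rewrite big_geq//; exact: cvg_cst.
  under eq_fun do rewrite big_nat_recr//=; rewrite big_nat_recr//=.
  exact: cvgD.
have /cvgrPdist_lt/(_ _ e4) cN' := cN.
near=> t.
have fMt : forall k, `|f k t| <= M k by near: t.
have h1 := dominated_series_tail N lM cM.
have h2 := dominated_series_tail N fMt cM.
have h3 : `|series l N - series (f^~ t) N| < e / 4 by near: t.
have -> : limn (series l) - limn (series (f^~ t)) =
  (limn (series l) - series l N) + (series l N - series (f^~ t) N)
   - (limn (series (f^~ t)) - series (f^~ t) N) by ring.
apply: le_lt_trans (ler_normB _ _) _.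
apply: (@lt_le_trans _ _ (e / 4 + e / 4 + e / 4)); last lra.
apply: ltr_leD; last by apply: le_trans h2 _; exact: ltW.
apply: le_lt_trans (ler_normD _ _) _.
by apply: ltrD => //; exact: le_lt_trans h1 _.
Unshelve. all: by end_near. Qed.

(** In Caratheodory's form of the derivatives, the slope functions [g k] are
    bounded by [M k] and continuous at [x]; by Tannery's theorem so is their
    sum, which is a slope function of the series. *)
Lemma is_derive_series (f df : nat -> R -> R) (M : nat -> R) (x : R) :
  (forall k (z : R), is_derive z 1 (f k) (df k z)) ->
  (forall k z, `|df k z| <= M k) -> cvgn (series M) ->
  (forall z, cvgn (series (f^~ z))) ->
  is_derive x 1 (fun z => limn (series (f^~ z))) (limn (series (df^~ x))).
Proof.
move=> fdf dfM cM cf.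
have /(_ _)/cid gP k := (is_derive1_caratheodory (f k) x (df k x)).1 (fdf k x).
pose g k := projT1 (gP k).
have gE k z : f k z - f k x = g k z * (z - x) by have [] := projT2 (gP k).
have gc k : {for x, continuous (g k)} by have [] := projT2 (gP k).
have gx k : g k x = df k x by have [] := projT2 (gP k).
have gM z k : `|g k z| <= M k.
  have [->|zx] := eqVneq z x; first by rewrite gx.
  have zx0 : 0 < `|z - x| by rewrite normr_gt0 subr_eq0.
  rewrite -(ler_pM2r zx0) -normrM -gE.
  exact: (MVT_le _ _ (fdf k)).
apply/is_derive1_caratheodory; exists (fun z => limn (series (g^~ z))); split.
- move=> z.
  rewrite -lim_seriesB// mulrC -[LHS]/(_ : R).
  have -> : series (f^~ z - f^~ x) = series ((z - x) *: (g^~ z)).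
    by congr series; apply/funext => k; rewrite /= [LHS]gE mulrC.
  rewrite lim_seriesZ//; exact: dominated_series_cvg (gM z) cM.
- rewrite /continuous_at.
  apply: (@tannery _ (nbhs x) (nbhs_pfilter x) g _ M cM); last by move=> k; exact: gc.
  by apply: nearW => t k; exact: gM.
- by congr (limn (series _)); apply/funext => k.
Qed.

End dominated_series.

(** * Trigonometric series *)

Section trigonometric_series.
Context {R : realType}.
Implicit Types (lam b : nat -> R).

Definition ssin lam b (x : R) : R := limn (series (fun k => b k * sin (lam k * x))).
Definition scos lam b (x : R) : R := limn (series (fun k => b k * cos (lam k * x))).

Section bounds.
Variables (lam b : nat -> R).
Hypothesis b0 : forall k, 0 <= b k.
Hypothesis cb : cvgn (series b).

Lemma ssin_term_le x k : `|b k * sin (lam k * x)| <= b k.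
Proof. by rewrite normrM (ger0_norm (b0 k)) ler_piMr// sin_max. Qed.

Lemma scos_term_le x k : `|b k * cos (lam k * x)| <= b k.
Proof. by rewrite normrM (ger0_norm (b0 k)) ler_piMr// cos_max. Qed.

Lemma cvg_ssin x : cvgn (series (fun k => b k * sin (lam k * x))).
Proof. exact: dominated_series_cvg (ssin_term_le x) cb. Qed.

Lemma cvg_scos x : cvgn (series (fun k => b k * cos (lam k * x))).
Proof. exact: dominated_series_cvg (scos_term_le x) cb. Qed.

Lemma ssin_le x : `|ssin lam b x| <= limn (series b).
Proof. exact: dominated_series_le (ssin_term_le x) cb. Qed.

Lemma scos_le x : `|scos lam b x| <= limn (series b).
Proof. exact: dominated_series_le (scos_term_le x) cb. Qed.

Lemma continuous_ssin : continuous (ssin lam b).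
Proof.
move=> x; rewrite /continuous_at.
apply: (@tannery _ _ (nbhs x) (nbhs_pfilter x) (fun k z => b k * sin (lam k * z)) _ b cb).
  by apply: nearW => z k; exact: ssin_term_le.
move=> k; apply: cvgMr.
exact: (is_derive_continuous (is_derive_sin_scale (lam k) x)).
Qed.

Lemma continuous_scos : continuous (scos lam b).
Proof.
move=> x; rewrite /continuous_at.
apply: (@tannery _ _ (nbhs x) (nbhs_pfilter x) (fun k z => b k * cos (lam k * z)) _ b cb).
  by apply: nearW => z k; exact: scos_term_le.
move=> k; apply: cvgMr.
exact: (is_derive_continuous (is_derive_cos_scale (lam k) x)).
Qed.

Hypothesis lam0 : forall k, 0 <= lam k.
Hypothesis cbl : cvgn (series (fun k => b k * lam k)).

Lemma is_derive_ssin (x : R) :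
  is_derive x 1 (ssin lam b) (scos lam (fun k => b k * lam k) x).
Proof.
refine (@is_derive_series R (fun k z => b k * sin (lam k * z))
  (fun k z => b k * lam k * cos (lam k * z)) (fun k => b k * lam k) x _ _ cbl _).
- by move=> k z; rewrite -mulrA; apply: is_derive_cmul; exact: is_derive_sin_scale.
- by move=> k z; rewrite normrM ger0_norm ?mulr_ge0// ler_piMr ?mulr_ge0// cos_max.
- exact: cvg_ssin.
Qed.

Lemma is_derive_scos (x : R) :
  is_derive x 1 (scos lam b) (- ssin lam (fun k => b k * lam k) x).
Proof.
have bl0 k : 0 <= b k * lam k by rewrite mulr_ge0.
rewrite /ssin -lim_seriesN; last first.
  apply: (@dominated_series_cvg _ _ (fun k => b k * lam k)) => // k.
  by rewrite normrM ger0_norm// ler_piMr// sin_max.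
refine (@is_derive_series R (fun k z => b k * cos (lam k * z))
  (fun k z => - (b k * lam k * sin (lam k * z))) (fun k => b k * lam k) x _ _ cbl _).
- move=> k z; rewrite -mulrA -mulrN; apply: is_derive_cmul; exact: is_derive_cos_scale.
- by move=> k z; rewrite normrN normrM ger0_norm// ler_piMr// sin_max.
- exact: cvg_scos.
Qed.

End bounds.

(** Interpolating the two bounds [2] and [lam k * |x - y|] for the oscillation
    of one mode gives every Hölder exponent between 0 and 1. *)
Lemma powR_interpolation (d th : R) : 0 <= d -> 0 <= th <= 1 ->
  forall a : R, 0 <= a -> a <= 2 -> a <= d -> a <= 2 * d `^ th.
Proof.
move=> d0 /andP[th0 th1] a a0 a2 ad.
have [d1|d1] := leP 1 d.
  apply: le_trans a2 _; rewrite ler_peMr//.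
  by rewrite -(powRr0 d) ler_powR.
have [d00|dn0] := eqVneq d 0.
  by rewrite d00 in ad *; apply: le_trans ad _; rewrite mulr_ge0// powR_ge0.
have dp : 0 < d by rewrite lt_neqAle eq_sym dn0.
apply: le_trans ad _; apply: (@le_trans _ _ (d `^ th)); last first.
  by rewrite ler_peMl ?powR_ge0// ler1n.
by apply: ger1_powR => //; rewrite dp ltW.
Qed.

Lemma dominated_series_holder (phi : nat -> R -> R) lam b (th : R) :
  (forall k, 0 <= b k) -> (forall k, 0 < lam k) -> 0 <= th <= 1 ->
  (forall k x, `|phi k x| <= 1) -> (forall k x y, `|phi k x - phi k y| <= lam k * `|x - y|) ->
  cvgn (series b) -> cvgn (series (fun k => b k * lam k `^ th)) ->
  forall x y, `|limn (series (fun k => b k * phi k x)) - limn (series (fun k => b k * phi k y))|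
    <= 2 * limn (series (fun k => b k * lam k `^ th)) * `|x - y| `^ th.
Proof.
move=> b0 lam0 th01 phi1 phil cb cbl x y.
have term z k : `|b k * phi k z| <= b k by rewrite normrM (ger0_norm (b0 k)) ler_piMr.
have cphi z := dominated_series_cvg (term z) cb.
rewrite -lim_seriesB//.
set g := (X in limn (series X)).
have gM k : `|g k| <= (2 * `|x - y| `^ th) * (b k * lam k `^ th).
  have -> : g k = b k * (phi k x - phi k y) by rewrite mulrBr.
  rewrite normrM (ger0_norm (b0 k)) mulrCA ler_wpM2l// -mulrA -powRM ?(ltW (lam0 k))//.
  rewrite (mulrC `|_|); apply: powR_interpolation => //.
    by rewrite mulr_ge0// ltW.
  apply: le_trans (ler_normB _ _) _.
  by rewrite -[2](_ : 1 + 1 = _)// lerD.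
have cM : cvgn (series (fun k => (2 * `|x - y| `^ th) * (b k * lam k `^ th))).
  exact: cvg_series_cmul.
apply: le_trans (dominated_series_le gM cM) _.
have -> : limn (series (fun k => (2 * `|x - y| `^ th) * (b k * lam k `^ th))) =
   (2 * `|x - y| `^ th) * limn (series (fun k => b k * lam k `^ th)).
  exact: lim_series_cmul.
by rewrite mulrAC.
Qed.

Lemma ssin_holder lam b (th : R) : 
  (forall k, 0 <= b k) -> (forall k, 0 < lam k) -> 0 <= th <= 1 ->
  cvgn (series b) -> cvgn (series (fun k => b k * lam k `^ th)) ->
  forall x y, `|ssin lam b x - ssin lam b y|
    <= 2 * limn (series (fun k => b k * lam k `^ th)) * `|x - y| `^ th.
Proof.
move=> b0 lam0 th01 cb cbl.
apply: (@dominated_series_holder (fun k x => sin (lam k * x))) => // [k x|k x y].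
  exact: sin_max.
by apply: le_trans (sin_lipschitz _ _) _; rewrite -mulrBr normrM gtr0_norm.
Qed.

Lemma scos_holder lam b (th : R) : 
  (forall k, 0 <= b k) -> (forall k, 0 < lam k) -> 0 <= th <= 1 ->
  cvgn (series b) -> cvgn (series (fun k => b k * lam k `^ th)) ->
  forall x y, `|scos lam b x - scos lam b y|
    <= 2 * limn (series (fun k => b k * lam k `^ th)) * `|x - y| `^ th.
Proof.
move=> b0 lam0 th01 cb cbl.
apply: (@dominated_series_holder (fun k x => cos (lam k * x))) => // [k x|k x y].
  exact: cos_max.
by apply: le_trans (cos_lipschitz _ _) _; rewrite -mulrBr normrM gtr0_norm.
Qed.

Lemma ssin0 lam b : ssin lam b 0 = 0.
Proof.
rewrite /ssin; under eq_fun do rewrite mulr0 sin0 mulr0.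
have -> : series (fun=> 0 : R) = cst 0.
  by apply/funext => n; rewrite /series/= big1.
exact: lim_cst.
Qed.

(** At [x = 1 / lam K] the modes between [K] and [2 K] all have phase in
    [1, 2], where [1 - cos] is bounded below; they are about [K] in number. *)
Lemma scos_oscillation_ge (w : R) b (c p : R) : 0 < w -> 0 < c -> 0 <= p ->
  (forall k, 0 <= b k) -> cvgn (series b) ->
  (forall k, c * oddn k `^ (- 1 - p) <= b k) ->
  exists2 c', 0 < c' & forall K : nat,
   c' * (w * oddn K)^-1 `^ p <=
   scos (fun k => w * oddn k) b 0 - scos (fun k => w * oddn k) b (w * oddn K)^-1.
Proof.
move=> w0 c0 p0 b0 cb cle.
have c1 : 0 < 1 - cos 1 :> R.
  rewrite subr_gt0 -[ltRHS]cos0 ltr_cos ?ltr01// in_itv/= ?lexx ?pi_ge0//.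
  by rewrite ler01 (le_trans _ (pi_ge2 R))// ler1n.
exists (c * (1 - cos 1) * 2 `^ (- 1 - p) / 2 * w `^ p).
  by rewrite mulr_gt0 ?powR_gt0// divr_gt0// mulr_gt0 ?powR_gt0// mulr_gt0.
move=> K; set x := (w * oddn K)^-1.
have nK := @oddn_gt0 R K.
have x0 : 0 < x by rewrite invr_gt0 mulr_gt0.
rewrite /scos -lim_seriesB; [|exact: cvg_scos|exact: cvg_scos].
set g := (X in limn (series X)).
have gE k : g k = b k * (1 - cos (w * oddn k * x)).
  by rewrite /g fctE/= mulr0 cos0 mulr1 mulrBr mulr1.
have g0 k : 0 <= g k by rewrite gE mulr_ge0// subr_ge0 cos_le1.
have cg : cvgn (series g).
  by apply: is_cvg_seriesB; exact: cvg_scos.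
apply: le_trans (ge0_series_lim_ge (K + K.+1)%N g0 cg).
rewrite /series/= (@big_cat_nat _ _ _ K)//=; last by rewrite leq_addr.
rewrite ler_wpDl//; first by apply: sumr_ge0.
apply: (@le_trans _ _ (\sum_(K <= k < K + K.+1) c * (2 * oddn K) `^ (- 1 - p) * (1 - cos 1))).
  rewrite big_const_nat -addnBAC// subnn add0n iter_addr_0 -[leRHS]mulr_natr.
  rewrite powRM ?(ltW nK)// (@powRB _ (oddn K) (-1) p); last by rewrite (gt_eqF nK) implybT.
  rewrite powR_inv1 ?(ltW nK)//.
  have -> : x `^ p = w `^ (- p) * (oddn K `^ p)^-1.
    by rewrite /x -powR_inv1 ?mulr_ge0 ?(ltW w0) ?(ltW nK)// -powRrM mulN1r powRM ?(ltW w0) ?(ltW nK)// -powRN.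
  have -> : c * (1 - cos 1) * 2 `^ (-1 - p) / 2 * w `^ p * (w `^ (- p) * (oddn K `^ p)^-1) =
     c * (1 - cos 1) * 2 `^ (-1 - p) * (oddn K `^ p)^-1 / 2.
    by rewrite powRN; field; rewrite !gt_eqF ?powR_gt0.
  have -> : c * (2 `^ (-1 - p) * ((oddn K)^-1 / oddn K `^ p)) * (1 - cos 1) * K.+1%:R =
     c * (1 - cos 1) * 2 `^ (-1 - p) * (oddn K `^ p)^-1 * (K.+1%:R / oddn K).
    by rewrite -mulrA; ring.
  rewrite ler_pM2l ?ler_pdivlMr//; last first.
    by rewrite mulr_gt0 ?invr_gt0 ?powR_gt0// mulr_gt0 ?powR_gt0// mulr_gt0.
  by rewrite ler_pdivrMl// /oddn -natrM ler_nat; lia.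
apply: ler_sum_nat => k /andP[Kk kK].
have nk := @oddn_gt0 R k.
have k2 : oddn k <= 2 * oddn K :> R.
  by rewrite /oddn -natrM ler_nat; lia.
have kx : w * oddn k * x = oddn k / oddn K.
  by rewrite /x invfM; field; rewrite !gt_eqF.
rewrite gE; apply: ler_pM.
- by rewrite mulr_ge0 ?(ltW c0)// powR_ge0.
- exact: ltW.
- apply: le_trans (cle k); rewrite ler_pM2l//.
  have -> : -1 - p = - (1 + p) by ring.
  rewrite !powRN lef_pV2 ?posrE ?powR_gt0 ?mulr_gt0//.
  by apply: ge0_ler_powR; rewrite ?nnegrE ?addr_ge0 ?mulr_ge0// ltW.
- rewrite kx lerD2l lerN2.
  have q1 : 1 <= oddn k / oddn K :> R.
    by rewrite ler_pdivlMr// mul1r /oddn ler_nat; lia.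
  have q2 : oddn k / oddn K <= 2 :> R by rewrite ler_pdivrMr.
  move: q1; rewrite le_eqVlt => /predU1P[<-//|q1].
  apply: ltW; rewrite ltr_cos// in_itv/=.
    by rewrite ler01 (le_trans _ (pi_ge2 R))// ler1n.
  by rewrite (le_trans q2 (pi_ge2 R)) andbT divr_ge0// ltW.
Qed.

End trigonometric_series.

(** * A mixture of powers *)

Section mixture.
Context {R : realType}.
Variable m : R.
Hypothesis m0 : 0 < m.

Definition mixw (j : nat) : R := 4^-1 ^+ j.
Definition mixe (j : nat) : R := m * 2^-1 ^+ j.
(** Each term bounds [ell] from below, so [ell] decays more slowly than every
    power, while the sum of [ell k / oddn k] still converges. A mixture of
    powers does this, where a power of a logarithm would also do, because it
    keeps the series with coefficients [mix p] a superposition of the series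
    [sineser (p + mixe j)], to which the Mellin representation applies. *)
Definition ell (k : nat) : R := limn (series (fun j => mixw j * oddn k `^ (- mixe j))).
Definition mix (p : R) (k : nat) : R := oddn k `^ (- 1 - p) * ell k.

Lemma mixw_gt0 j : 0 < mixw j. Proof. by rewrite exprn_gt0. Qed.
Lemma mixe_gt0 j : 0 < mixe j. Proof. by rewrite mulr_gt0// exprn_gt0. Qed.
Lemma mixe_le j : mixe j <= m.
Proof. by rewrite ler_piMr ?(ltW m0)// exprn_ile1//; lra. Qed.

Lemma sum_half_le J : \sum_(0 <= j < J) (2^-1 : R) ^+ j <= 2.
Proof.
suff -> : \sum_(0 <= j < J) (2^-1 : R) ^+ j = 2 - 2 * 2^-1 ^+ J.
  by rewrite gerBl mulr_ge0// exprn_ge0.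
elim: J => [|J IH]; first by rewrite big_nil expr0 mulr1 subrr.
by rewrite big_nat_recr//= IH exprS; field.
Qed.

Lemma mixw_le_half j : mixw j <= 2^-1 ^+ j.
Proof. by apply: lerXn2r; rewrite ?nnegrE//; lra. Qed.

Lemma cvg_half : cvgn (series (fun j => (2^-1 : R) ^+ j)).
Proof.
apply: nondecreasing_is_cvgn.
  by apply: nondecreasing_series => k _ _; exact: exprn_ge0.
by exists 2 => _ [N _ <-]; exact: sum_half_le.
Qed.

Lemma cvg_mixw : cvgn (series mixw).
Proof.
apply: dominated_series_cvg cvg_half => j.
by rewrite ger0_norm ?(ltW (mixw_gt0 j))// mixw_le_half.
Qed.

Lemma lim_mixw_le : limn (series mixw) <= 2.
Proof.
apply: limr_le; first exact: cvg_mixw.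
apply: nearW => J; apply: le_trans (sum_half_le J).
by apply: ler_sum => j _; exact: mixw_le_half.
Qed.

Lemma mixw_sum_le J : series mixw J <= 2.
Proof.
apply: le_trans lim_mixw_le.
by apply: ge0_series_lim_ge cvg_mixw => j; rewrite ltW// mixw_gt0.
Qed.

Lemma oddn_powRN_le1 k (e : R) : 0 <= e -> oddn k `^ (- e) <= 1.
Proof.
move=> e0; rewrite powRN invf_le1 ?powR_gt0 ?oddn_gt0//.
by rewrite -[leLHS](powRr0 (oddn k)) ler_powR// oddn_ge1.
Qed.

Lemma ell_term_le k j : `|mixw j * oddn k `^ (- mixe j)| <= mixw j.
Proof.
rewrite ger0_norm ?mulr_ge0 ?powR_ge0 ?(ltW (mixw_gt0 j))//.
by rewrite ler_piMr ?(ltW (mixw_gt0 j))// oddn_powRN_le1// ltW// mixe_gt0.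
Qed.

Lemma cvg_ell k : cvgn (series (fun j => mixw j * oddn k `^ (- mixe j))).
Proof. exact: dominated_series_cvg (ell_term_le k) cvg_mixw. Qed.

Lemma ell_ge k j : mixw j * oddn k `^ (- mixe j) <= ell k.
Proof.
have h i : 0 <= mixw i * oddn k `^ (- mixe i) by rewrite mulr_ge0 ?powR_ge0// ltW// mixw_gt0.
apply: (@le_trans _ _ (series (fun j => mixw j * oddn k `^ (- mixe j)) j.+1)).
  by rewrite seriesSr/= lerDr sumr_ge0.
rewrite /ell; have := ge0_series_lim_ge j.+1 h (@cvg_ell k).
exact.
Qed.

Lemma ell_gt0 k : 0 < ell k.
Proof. by apply: lt_le_trans (ell_ge k 0); rewrite mulr_gt0 ?mixw_gt0// powR_gt0// oddn_gt0. Qed.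

Lemma mix_gt0 p k : 0 < mix p k.
Proof. by rewrite mulr_gt0 ?ell_gt0// powR_gt0// oddn_gt0. Qed.

Lemma mix_ge0 p k : 0 <= mix p k. Proof. by rewrite ltW// mix_gt0. Qed.

Lemma mix_powR p q k : mix p k * oddn k `^ q = mix (p - q) k.
Proof.
rewrite /mix mulrAC -powRD; last by rewrite (gt_eqF (oddn_gt0 k)) implybT.
by congr (_ `^ _ * _); ring.
Qed.

Lemma mix_ge p k j : mixw j * oddn k `^ (- 1 - (p + mixe j)) <= mix p k.
Proof.
have -> : - 1 - (p + mixe j) = (- 1 - p) + (- mixe j) by ring.
rewrite powRD; last by rewrite (gt_eqF (oddn_gt0 k)) implybT.
by rewrite mulrCA ler_wpM2l ?powR_ge0// ell_ge.
Qed.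

(** The mass [4 ^ - j] of the exponent [mixe j] pays for the bound [1 + 1 /
    mixe j], of order [2 ^ j], of the sum of [oddn k ^ (- 1 - mixe j)]. *)
Lemma cvg_mix0 : cvgn (series (mix 0)).
Proof.
apply: nondecreasing_is_cvgn.
  by apply: nondecreasing_series => k _ _; exact: mix_ge0.
exists (2 * (1 + m^-1)) => _ [K _ <-].
have cK : (fun J => \sum_(0 <= k < K) oddn k `^ (- 1 - 0) * series (fun j => mixw j * oddn k `^ (- mixe j)) J)
    @ \oo --> series (mix 0) K.
  rewrite /series/=; elim: K => [|K IH].
    by under eq_fun do rewrite big_geq//; rewrite big_geq//; exact: cvg_cst.
  under eq_fun do rewrite big_nat_recr//=; rewrite big_nat_recr//=.
  by apply: cvgD => //; apply: cvgMr; exact: cvg_ell.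
rewrite -(cvg_lim _ cK)//; apply: limr_le; first by apply/cvg_ex; eexists; exact: cK.
apply: nearW => J.
apply: (@le_trans _ _ (\sum_(0 <= j < J) (2^-1 ^+ j * (1 + m^-1)))); last first.
  by rewrite -mulr_suml ler_wpM2r ?sum_half_le// addr_ge0// invr_ge0 ltW.
rewrite /series/=; under eq_bigr do rewrite mulr_sumr.
rewrite exchange_big/=; apply: ler_sum => j _.
have e0 := mixe_gt0 j.
apply: (@le_trans _ _ (mixw j * (1 + (mixe j)^-1))).
  apply: le_trans (ler_wpM2l (ltW (mixw_gt0 j)) (sum_oddn_powR_le K e0)).
  rewrite mulr_sumr; apply: ler_sum => k _; rewrite mulrCA ler_wpM2l ?(ltW (mixw_gt0 j))//.
  rewrite -powRD; last by rewrite (gt_eqF (oddn_gt0 k)) implybT.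
  by rewrite subr0.
rewrite !mulrDr !mulr1; apply: lerD; first exact: mixw_le_half.
rewrite /mixe invfM mulrCA mulrC ler_wpM2r ?invr_ge0 ?(ltW m0)//.
rewrite /mixw -exprVn invrK -exprMn.
have -> : 4^-1 * 2 = 2^-1 :> R by field.
by [].
Qed.

Lemma cvg_mix p : 0 <= p -> cvgn (series (mix p)).
Proof.
move=> p0; apply: dominated_series_cvg cvg_mix0 => k.
rewrite ger0_norm ?mix_ge0// /mix ler_wpM2r ?(ltW (ell_gt0 k))//.
by apply: ler_powR; [exact: oddn_ge1|rewrite lerD2l lerN2].
Qed.

(** This exchanges the sums over [k] and [j]. Truncating the mixture at [J]
    leaves finitely many series, and Tannery's theorem lets [J] tend to
    infinity inside the sum over [k], as the truncations of [ell] are bounded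
    by 2. *)
Lemma ssin_mix_approx p x : 0 < p ->
  (fun J => \sum_(0 <= j < J) mixw j * sineser (p + mixe j) x) @ \oo --> ssin oddn (mix p) x.
Proof.
move=> p0.
pose f J k := oddn k `^ (- 1 - p) * series (fun j => mixw j * oddn k `^ (- mixe j)) J * sin (oddn k * x).
have cp := cvg_series_oddn_powR p0.
have fM J k : `|f J k| <= 2 * oddn k `^ (- 1 - p).
  rewrite normrM mulrC; apply: (@le_trans _ _ (1 * `|oddn k `^ (- 1 - p) * series (fun j => mixw j * oddn k `^ (- mixe j)) J|)).
    by rewrite ler_wpM2r// sin_max.
  rewrite mul1r normrM ger0_norm ?powR_ge0// mulrC ler_wpM2r ?powR_ge0//.
  apply: le_trans (ler_norm_sum _ _ _) _; apply: le_trans (mixw_sum_le J).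
  by apply: ler_sum => j _; exact: ell_term_le.
have E J : \sum_(0 <= j < J) mixw j * sineser (p + mixe j) x = limn (series (f J)).
  elim: J => [|J IH].
    rewrite big_nil; have -> : f 0%N = cst 0.
      by apply/funext => k; rewrite /f /series/= big_nil mulr0 mul0r.
    have -> : series (cst 0 : nat -> R) = cst 0.
      by apply/funext => n; rewrite /series/= big1.
    by rewrite lim_cst.
  have pe : 0 < p + mixe J by rewrite addr_gt0// mixe_gt0.
  rewrite big_nat_recr//= IH /sineser -lim_series_cmul; last exact: cvg_sineser.
  rewrite -lim_seriesD; last 2 first.
  - by apply: (@dominated_series_cvg _ _ (fun k => 2 * oddn k `^ (- 1 - p)) (fM J)); exact: cvg_series_cmul.
  - by apply: cvg_series_cmul; exact: cvg_sineser.
  congr (limn (series _)); apply/funext => k.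
  rewrite /f [LHS]/= seriesSr/= fctE.
  have -> : - 1 - (p + mixe J) = (- 1 - p) + (- mixe J) by ring.
  rewrite (@powRD _ _ (- 1 - p) (- mixe J)); last by rewrite (gt_eqF (oddn_gt0 k)) implybT.
  ring.
under eq_fun do rewrite E.
apply: (@tannery _ _ \oo _ (fun k J => f J k) _ (fun k => 2 * oddn k `^ (- 1 - p))).
- exact: cvg_series_cmul.
- by apply: nearW => J k; exact: fM.
- by move=> k; apply: cvgMl; apply: cvgMr; exact: cvg_ell.
Qed.

End mixture.

Section mixture_comparison.
Context {R : realType}.
Variables (m : R).
Hypotheses (m0 : 0 < m) (m1 : m <= 1).
Local Notation U p := (ssin oddn (mix m p)).
Variables (x y : R).
Hypothesis yx : sin y <= sin x.

Let approx p : 0 < p ->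
  (fun J => \sum_(0 <= j < J) mixw j * (sineser (p + mixe m j) x - sineser (p + mixe m j) y))
    @ \oo --> U p x - U p y.
Proof.
move=> p0; under eq_fun do under eq_bigr do rewrite mulrBr.
under eq_fun do rewrite sumrB.
by apply: cvgB; exact: ssin_mix_approx.
Qed.

Let diff_ge0 p j : 0 < p -> 0 <= sineser (p + mixe m j) x - sineser (p + mixe m j) y.
Proof. by move=> p0; rewrite subr_ge0 sineser_mono// addr_gt0// mixe_gt0. Qed.

(** All components of the mixture have nonnegative increments, and that of the
    exponent [mixe 0 = m] alone is this large. *)
Lemma ssin_mix_sub_lower p : 0 < p ->
  expR (- 2) / 10 / Gamma (p + m) * (sin x - sin y) <= U p x - U p y.
Proof.
move=> p0; have pm : 0 < p + m by rewrite addr_gt0.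
rewrite -(cvg_lim _ (approx p0))//; apply: limr_ge; first by apply/cvg_ex; eexists; exact: approx.
exists 1%N => //= J J1; rewrite (big_ltn J1) /= {1}/mixw {1 2}/mixe expr0 mul1r mulr1.
apply: ler_wpDr.
  by apply: sumr_ge0 => j _; rewrite mulr_ge0 ?diff_ge0// ltW// mixw_gt0.
rewrite mulrAC ler_pdivrMr ?Gamma_gt0// mulrC [leRHS]mulrC mulrC.
exact: sineser_lower.
Qed.

Lemma ssin_mix_mono p : 0 < p -> U p y <= U p x.
Proof.
move=> p0; rewrite -subr_ge0; apply: le_trans (ssin_mix_sub_lower p0).
rewrite mulr_ge0 ?subr_ge0// divr_ge0 ?divr_ge0 ?expR_ge0//.
by rewrite ltW// Gamma_gt0// addr_gt0.
Qed.

(** The component of exponent [p + e] is at most a constant times [d ^ (p + e)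
    <= 2 d ^ p], since [d <= 2] and [e <= 1]. The condition [p + m < 1] keeps
    the constants bounded over the mixture. *)
Lemma ssin_mix_sub_holder p : 0 < p -> p + m < 1 ->
  U p x - U p y <= 4 * (pi / 2 / p + (1 - (p + m))^-1) / (expR (- 2) / 2) * (sin x - sin y) `^ p.
Proof.
move=> p0 pm1.
set d := sin x - sin y.
have d0 : 0 <= d by rewrite subr_ge0.
have d2 : d <= 2 by rewrite /d; have := sin_le1 x; have := sin_geN1 y; lra.
set A := pi / 2 / p + (1 - (p + m))^-1.
have A0 : 0 <= A.
  by rewrite addr_ge0// ?invr_ge0 ?subr_ge0 ?(ltW pm1)// divr_ge0 ?divr_ge0 ?pi_ge0// ltW.
set G := expR (- 2) / 2.
have G0 : 0 < G by rewrite divr_gt0// expR_gt0.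
have term j : sineser (p + mixe m j) x - sineser (p + mixe m j) y <= 2 * A / G * d `^ p.
  have e0 := mixe_gt0 m0 j; have em := mixe_le m0 j.
  have pe : 0 < p + mixe m j by rewrite addr_gt0.
  have pe1 : p + mixe m j < 1 by apply: le_lt_trans pm1; rewrite lerD2l.
  have := sineser_holder yx pe pe1; rewrite -/d => H.
  have Gp := Gamma_lower pe; rewrite -/G in Gp.
  rewrite -(ler_pM2l G0); apply: (@le_trans _ _ (Gamma (p + mixe m j) * (sineser (p + mixe m j) x - sineser (p + mixe m j) y))).
    by rewrite ler_wpM2r// diff_ge0.
  apply: le_trans H _.
  have -> : G * (2 * A / G * d `^ p) = A * (2 * d `^ p) by field; rewrite gt_eqF.
  apply: ler_pM.
  - by rewrite addr_ge0// ?invr_ge0 ?subr_ge0 ?(ltW pe1)// divr_ge0 ?divr_ge0 ?pi_ge0// ltW.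
  - exact: powR_ge0.
  - rewrite lerD//.
      rewrite ler_wpM2l ?divr_ge0 ?pi_ge0// lef_pV2 ?posrE// lerDl ltW//.
    by rewrite lef_pV2 ?posrE ?subr_gt0// lerD2l lerN2 lerD2l.
  - have [->|dn0] := eqVneq d 0.
      by rewrite !powR0 ?gt_eqF// mulr0.
    rewrite powRD; last by rewrite dn0 implybT.
    rewrite mulrC ler_wpM2r ?powR_ge0//.
    apply: (@le_trans _ _ (2 `^ mixe m j)).
      by apply: ge0_ler_powR; rewrite ?nnegrE ?(ltW e0).
    rewrite -[leRHS]powRr1//; apply: ler_powR => //; first by rewrite ler1n.
    exact: le_trans em m1.
rewrite -(cvg_lim _ (approx p0))//; apply: limr_le; first by apply/cvg_ex; eexists; exact: approx.
apply: nearW => J.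
apply: (@le_trans _ _ (\sum_(0 <= j < J) mixw j * (2 * A / G * d `^ p))).
  by apply: ler_sum => j _; rewrite ler_wpM2l ?term// ltW// mixw_gt0.
rewrite -mulr_suml; apply: le_trans (ler_wpM2r _ (mixw_sum_le J)) _.
  by rewrite !mulr_ge0 ?powR_ge0 ?invr_ge0 ?(ltW G0).
by rewrite le_eqVlt; apply/orP; left; apply/eqP; ring.
Qed.

(** The interpolation inequality for each component with one and the same
    [tau], summed over the mixture. The bounds on Gamma make the constants
    uniform, and [tau <= 1] disposes of the extra powers of [tau]. *)
Lemma ssin_mix_sub_split p' p tau : 0 < p' -> p' <= p -> 0 < tau -> tau <= 1 ->
  expR (- 2) / 2 * (U p' x - U p' y) <=
  2 * (pi / 2 / p') * tau `^ p' +
  (Gamma p + Gamma (p + m)) * (tau `^ (p' - p) * (U p x - U p y)).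
Proof.
move=> p'0 p'p tau0 tau1; have p0 := lt_le_trans p'0 p'p.
set G := expR (- 2) / 2; set H := Gamma p + Gamma (p + m); set A := pi / 2 / p'.
have G0 : 0 < G by rewrite divr_gt0// expR_gt0.
have H0 : 0 < H by rewrite addr_gt0// Gamma_gt0// addr_gt0.
have A0 : 0 <= A by rewrite divr_ge0 ?divr_ge0 ?pi_ge0// ltW.
have term j : G * (sineser (p' + mixe m j) x - sineser (p' + mixe m j) y) <=
    A * tau `^ p' + H * (tau `^ (p' - p) * (sineser (p + mixe m j) x - sineser (p + mixe m j) y)).
  have e0 := mixe_gt0 m0 j; have em := mixe_le m0 j.
  have pe' : 0 < p' + mixe m j by rewrite addr_gt0.
  have pe'pe : p' + mixe m j <= p + mixe m j by rewrite lerD2r.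
  have := sineser_interpolation yx pe' pe'pe tau0.
  have -> : p' + mixe m j - (p + mixe m j) = p' - p by ring.
  move=> I.
  apply: (@le_trans _ _ (Gamma (p' + mixe m j) * (sineser (p' + mixe m j) x - sineser (p' + mixe m j) y))).
    by rewrite ler_wpM2r ?diff_ge0// Gamma_lower.
  apply: le_trans I _; apply: lerD.
    rewrite /A -[leRHS]mulrA ler_wpM2l ?divr_ge0 ?pi_ge0// mulrC; apply: ler_pM.
    - by rewrite invr_ge0 ltW.
    - exact: powR_ge0.
    - by rewrite lef_pV2 ?posrE// lerDl ltW.
    - by apply: ger_powR; rewrite ?tau0// lerDl ltW.
  rewrite mulrCA ler_wpM2r ?mulr_ge0 ?powR_ge0 ?diff_ge0//.
  by apply: Gamma_upper => //; rewrite ltW.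
have partial J : \sum_(0 <= j < J) mixw j * (sineser (p + mixe m j) x - sineser (p + mixe m j) y)
    <= U p x - U p y.
  rewrite -(cvg_lim _ (approx p0))//; apply: (@nondecreasing_cvgn_le _ (fun J => \sum_(0 <= j < J) mixw j * (sineser (p + mixe m j) x - sineser (p + mixe m j) y))).
    apply: (@nondecreasing_series _ (fun j => mixw j * (sineser (p + mixe m j) x - sineser (p + mixe m j) y)) xpredT) => j _ _.
    by rewrite mulr_ge0 ?diff_ge0// ltW// mixw_gt0.
  by apply/cvg_ex; eexists; exact: approx.
have cG : (fun J => G * \sum_(0 <= j < J) mixw j * (sineser (p' + mixe m j) x - sineser (p' + mixe m j) y)) @ \oo --> G * (U p' x - U p' y).
  by apply: cvgMr; exact: approx.
rewrite -(cvg_lim _ cG)//; apply: limr_le; first by apply/cvg_ex; eexists; exact: cG.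
apply: nearW => J.
rewrite mulr_sumr.
apply: (@le_trans _ _ (\sum_(0 <= j < J) (mixw j * (A * tau `^ p') + H * tau `^ (p' - p) * (mixw j * (sineser (p + mixe m j) x - sineser (p + mixe m j) y))))).
  apply: ler_sum => j _; rewrite mulrCA.
  have /le_trans := ler_wpM2l (ltW (@mixw_gt0 R j)) (term j); apply.
  by rewrite le_eqVlt; apply/orP; left; apply/eqP; ring.
rewrite big_split/= -mulr_suml -mulr_sumr; apply: lerD.
  by have sJ := @mixw_sum_le R J; rewrite -[leRHS]mulrA ler_wpM2r// mulr_ge0// powR_ge0.
by rewrite mulrA ler_wpM2l ?mulr_ge0 ?powR_ge0 ?(ltW H0).
Qed.

End mixture_comparison.

(** The choice [tau = (I / M)^(1/p)] balances the two terms of the splitting,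
    [I] being the increment of the series of exponent [p] and [M] a bound for it. *)
Lemma ssin_mix_sub_interpolation {R : realType} (m p' p : R) : 0 < m -> 0 < p' -> p' <= p ->
  exists2 C : R, 0 <= C & forall x y, sin y <= sin x ->
    ssin oddn (mix m p') x - ssin oddn (mix m p') y <=
    C * (ssin oddn (mix m p) x - ssin oddn (mix m p) y) `^ (p' / p).
Proof.
move=> m0 p'0 p'p; have p0 := lt_le_trans p'0 p'p.
set S := limn (series (mix m p)).
have cS : cvgn (series (mix m p)) by apply: cvg_mix => //; exact: ltW.
have S0 : 0 <= S.
  rewrite /S; apply: le_trans (ge0_series_lim_ge 0 _ cS) => //.
    by rewrite /series/= big_geq.
  by move=> k; exact: mix_ge0.
pose M := 2 * S + 1.
have M1 : 1 <= M by rewrite /M; lra.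
have M0 : 0 < M by apply: lt_le_trans M1.
set G : R := expR (- 2) / 2; set H := Gamma p + Gamma (p + m); set A : R := pi / 2 / p'.
have G0 : 0 < G by rewrite divr_gt0// expR_gt0.
have H0 : 0 < H by rewrite addr_gt0// Gamma_gt0// addr_gt0.
have A0 : 0 <= A by rewrite divr_ge0 ?divr_ge0 ?pi_ge0// ltW.
exists ((2 * A + H * M) / G).
  by rewrite divr_ge0 ?(ltW G0)// addr_ge0// mulr_ge0// ltW.
move=> x y yx.
set I := ssin oddn (mix m p) x - ssin oddn (mix m p) y.
have I0 : 0 <= I by rewrite subr_ge0; exact: ssin_mix_mono.
have IM : I <= M.
  have := ssin_le oddn (mix_ge0 m0 p) cS x; have := ssin_le oddn (mix_ge0 m0 p) cS y.
  rewrite -/S !ler_norml /I /M; lra.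
have [Iz|In0] := eqVneq I 0.
  have sxy : sin x <= sin y.
    have := ssin_mix_sub_lower m0 yx p0; rewrite -/I Iz.
    rewrite pmulr_rle0 ?subr_le0// divr_gt0 ?divr_gt0 ?expR_gt0// Gamma_gt0// addr_gt0//.
  have := ssin_mix_mono m0 sxy p'0; rewrite -subr_le0 => /le_trans; apply.
  by rewrite mulr_ge0 ?powR_ge0// divr_ge0 ?(ltW G0)// addr_ge0// mulr_ge0// ltW.
have Ip : 0 < I by rewrite lt_neqAle eq_sym In0.
pose q := I / M.
have q0 : 0 < q by rewrite divr_gt0.
have q1 : q <= 1 by rewrite ler_pdivrMr// mul1r.
pose tau := q `^ p^-1.
have tau0 : 0 < tau by rewrite powR_gt0.
have tau1 : tau <= 1.
  have -> : 1 = 1 `^ p^-1 :> R by rewrite powR1.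
  by apply: ge0_ler_powR; rewrite ?nnegrE ?invr_ge0 ?(ltW p0) ?(ltW q0).
have := ssin_mix_sub_split m0 yx p'0 p'p tau0 tau1; rewrite -/G -/H -/A -/I => B.
rewrite mulrAC ler_pdivlMr// mulrC; apply: le_trans B _.
have E1 : tau `^ p' = q `^ (p' / p) by rewrite /tau -powRrM mulrC.
have E2 : tau `^ (p' - p) * I = M * q `^ (p' / p).
  rewrite /tau -powRrM.
  have -> : p^-1 * (p' - p) = p' / p - 1 by field; rewrite gt_eqF.
  rewrite powRB; last by rewrite (gt_eqF q0) implybT.
  rewrite powRr1 ?(ltW q0)// {2}/q; field.
  by rewrite !gt_eqF.
have qI : q `^ (p' / p) <= I `^ (p' / p).
  apply: ge0_ler_powR; rewrite ?nnegrE ?(ltW q0) ?divr_ge0 ?(ltW p0) ?(ltW p'0)//.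
  by rewrite ler_pdivrMr// ler_peMr.
rewrite E1 E2 (mulrA H) -mulrDl ler_wpM2l// addr_ge0// mulr_ge0// ltW//.
Qed.

(** * The fractional Laplacian of a sine series *)

Section fractional_laplacian.
Context {R : realType}.
Local Notation mu := (@lebesgue_measure R).
Variable s : R.
Hypotheses (s0 : 0 < s) (s1 : s < 1).

Definition outside (e : R) : set R := [set h | e < `|h|].

Lemma measurable_outside e : measurable (outside e).
Proof.
have -> : outside e = (fun h : R => `|h|) @^-1` `]e, +oo[.
  by apply/seteqP; split => h; rewrite /outside/= in_itv/= andbT.
rewrite -[X in measurable X]setTI.
exact: (@normr_measurable R setT).
Qed.

Lemma outside_setU e : 0 <= e -> outside e = `]e, +oo[%classic `|` `]-oo, (- e)[%classic.
Proof.
move=> e0; apply/seteqP; split => h; rewrite /outside/= !in_itv/= andbT.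
  by rewrite lter_normr => /orP[|]; [left|right; rewrite ltrNr].
by rewrite lter_normr ltrNr => -[->//|->]; rewrite orbT.
Qed.

Lemma outside_disj e : 0 <= e -> [disjoint (`]e, +oo[%classic : set R) & (`]-oo, (- e)[%classic : set R)].
Proof.
move=> e0; apply/disj_setPS => x [] /=; rewrite !in_itv/= andbT => ex xe.
by have := lt_trans ex xe; lra.
Qed.

Lemma measurable_powR_norm (D : set R) (p : R) : measurable_fun D (fun h : R => `|h| `^ p).
Proof.
apply: measurable_funTS; apply: (measurableT_comp (measurable_powR p)).
exact: normr_measurable.
Qed.

Lemma preimage_opp_ray (e : R) : (-%R : R -> R) @^-1` `]-oo, (- e)[ = `]e, +oo[%classic.
Proof. by apply/seteqP; split => h /=; rewrite !in_itv/= andbT ltrN2. Qed.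

Lemma measure_opp (A : set R) : measurable A -> mu ((-%R : R -> R) @^-1` A) = mu A.
Proof. by move=> mA; have := lebesgue_measureN mA. Qed.

Lemma ge0_integral_even_outside (g : R -> R) (e : R) : 0 <= e ->
  measurable_fun setT g -> (forall h, 0 <= g h) -> (forall h, g (- h) = g h) ->
  (\int[mu]_(h in outside e) (g h)%:E = 2%:E * \int[mu]_(h in `]e, +oo[) (g h)%:E)%E.
Proof.
move=> e0 mg g0 ge.
have mg' (D : set R) : measurable_fun D (EFin \o g) by apply/measurable_EFinP; exact: measurable_funTS.
rewrite outside_setU// ge0_integral_setU//.
- rewrite mule_natl mule2n; congr (_ + _)%E.
  rewrite (@ge0_integral_measure_preserving _ (-%R) `]-oo, (- e)[)//.
  + by rewrite preimage_opp_ray; apply: eq_integral => h _; rewrite ge.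
  + exact: measure_opp.
- exact: mg'.
- by move=> h _; rewrite lee_fin.
- exact: outside_disj.
Qed.

Lemma integral_outside_powR_le (e : R) : 0 < e ->
  (\int[mu]_(h in outside e) (`|h| `^ (- (1 + 2 * s)))%:E <= (2 * (e `^ (- (2 * s)) / (2 * s)))%:E)%E.
Proof.
move=> e0; have s2 : 0 < 2 * s by rewrite mulr_gt0.
rewrite ge0_integral_even_outside ?(ltW e0)//; last 2 first.
- exact: measurable_powR_norm.
- by move=> h; rewrite normrN.
rewrite [leRHS]EFinM lee_wpmul2l ?lee_fin//.
apply: le_trans (integral_powRy_le s2 e0).
rewrite -integral_itv_obnd_cbnd; last first.
  by apply/measurable_EFinP; apply: measurable_funTS; exact: measurable_powR.
rewrite le_eqVlt; apply/orP; left; apply/eqP; apply: eq_integral => h.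
rewrite inE/= in_itv/= andbT => eh; rewrite gtr0_norm; last exact: lt_trans eh.
by congr ((_ `^ _)%:E); ring.
Qed.

Lemma measurable_fl_dom (x e : R) : measurable (fl_dom x e).
Proof.
have -> : fl_dom x e = (fun y : R => `|x - y|) @^-1` `]e, +oo[.
  by apply/seteqP; split => h; rewrite /fl_dom/= in_itv/= andbT.
rewrite -[X in measurable X]setTI.
have : measurable_fun setT (fun y : R => `|x - y|).
  apply: measurableT_comp; first exact: normr_measurable.
  by apply: measurable_funB.
by apply.
Qed.

Lemma integral_fl_dom_shift (x e : R) (f : R -> \bar R) :
  measurable_fun (fl_dom x e) f ->
  (\int[mu]_(y in fl_dom x e) f y = \int[mu]_(h in outside e) f (x + h)%R)%E.
Proof.
move=> mf.
rewrite (@integral_measure_preserving _ (fun h => x + h) (fl_dom x e))//.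
- congr (integral _ _ _); apply/seteqP; split => h; rewrite /fl_dom /outside/=;
    by rewrite opprD addrA subrr sub0r normrN.
- exact: measurable_funD.
- by move=> A; exact: lebesgue_measure_shift.
- exact: measurable_fl_dom.
Qed.

Lemma measurable_dist_powR (D : set R) (x p : R) : measurable_fun D (fun y : R => `|x - y| `^ p).
Proof.
apply: measurable_funTS; apply: (measurableT_comp (measurable_powR p)).
apply: measurableT_comp; first exact: normr_measurable.
by apply: measurable_funB.
Qed.

Lemma integrable_dist_powR (x e : R) : 0 < e ->
  mu.-integrable (fl_dom x e) (EFin \o (fun y => `|x - y| `^ (- (1 + 2 * s)))).
Proof.
move=> e0.
have [] // := @ge0_integrable_le R (fl_dom x e) (fun y => `|x - y| `^ (- (1 + 2 * s)))
   (2 * (e `^ (- (2 * s)) / (2 * s))).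
- exact: measurable_fl_dom.
- exact: measurable_dist_powR.
- rewrite integral_fl_dom_shift; last by apply/measurable_EFinP; exact: measurable_dist_powR.
  apply: le_trans (integral_outside_powR_le e0).
  rewrite le_eqVlt; apply/orP; left; apply/eqP; apply: eq_integral => h _.
  by rewrite opprD addrA subrr sub0r normrN.
Qed.

Lemma measurable_fl_kernel (D : set R) (u : R -> R) x : continuous u -> measurable_fun D (fl_kernel s u x).
Proof.
move=> cu; rewrite (_ : fl_kernel s u x = fun y => (u x - u y) * `|x - y| `^ (- (1 + 2 * s))).
  apply: measurable_funM; last exact: measurable_dist_powR.
  by apply: measurable_funTS; apply: measurable_funB => //; exact: continuous_measurable_fun.
by apply/funext => y; rewrite /fl_kernel powRN.
Qed.

Lemma fl_kernel_le (u : R -> R) (M x y : R) : (forall z, `|u z| <= M) ->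
  `|fl_kernel s u x y| <= 2 * M * `|x - y| `^ (- (1 + 2 * s)).
Proof.
move=> uM; rewrite /fl_kernel normrM normfV (ger0_norm (powR_ge0 _ _)) -powRN.
rewrite ler_wpM2r ?powR_ge0//; apply: le_trans (ler_normB _ _) _.
by have := uM x; have := uM y; lra.
Qed.

Lemma integrable_fl_kernel (u : R -> R) (M x e : R) : continuous u ->
  (forall z, `|u z| <= M) -> 0 < e ->
  mu.-integrable (fl_dom x e) (EFin \o fl_kernel s u x).
Proof.
move=> cu uM e0.
have i1 := integrable_EFinZl (2 * M) (measurable_fl_dom x e) (integrable_dist_powR x e0).
apply: le_integrable i1 => //.
- exact: measurable_fl_dom.
- by apply/measurable_EFinP; exact: measurable_fl_kernel.
- move=> y _ /=; rewrite lee_fin; apply: le_trans (fl_kernel_le x y uM) _.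
  exact: ler_norm.
Qed.

Definition cos_kernel (h : R) : R := (1 - cos h) * `|h| `^ (- (1 + 2 * s)).
(** The symbol at frequency 1 of the operator truncated at distance [e]. *)
Definition kappa (e : R) : R := \int[mu]_(h in outside e) cos_kernel h.

Lemma cos_kernel_ge0 h : 0 <= cos_kernel h.
Proof. by rewrite mulr_ge0 ?powR_ge0// subr_ge0 cos_le1. Qed.

Lemma measurable_cos_kernel (D : set R) : measurable_fun D cos_kernel.
Proof.
apply: measurable_funM; last exact: measurable_powR_norm.
by apply: measurable_funTS; apply: measurable_funB => //; apply: continuous_measurable_fun; exact: continuous_cos.
Qed.

Lemma one_sub_cos_le (h : R) : 1 - cos h <= h ^+ 2.
Proof.
have -> : 1 - cos h = 2 * sin (h / 2) ^+ 2.
  have {1}-> : h = (h / 2) *+ 2 by rewrite -mulr_natr divfK.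
  by rewrite cos_mulr2n cos2sin2; ring.
have h1 : `|sin (h / 2)| <= `|h / 2| by have := sin_lipschitz (h / 2) 0; rewrite sin0 !subr0.
have : sin (h / 2) ^+ 2 <= (h / 2) ^+ 2.
  by rewrite -(real_normK (num_real (sin _))) -(real_normK (num_real (h / 2))) lerXn2r// nnegrE.
rewrite expr_div_n; have := sqr_ge0 h; lra.
Qed.

Lemma integrable_cos_kernel : mu.-integrable (outside 0) (EFin \o cos_kernel).
Proof.
have s2 : 0 < 2 * s by rewrite mulr_gt0.
have s3 : 0 < 2 - 2 * s by rewrite subr_gt0 gtr_pMr.
have mck (D : set R) : measurable_fun D (EFin \o cos_kernel).
  by apply/measurable_EFinP; exact: measurable_cos_kernel.
have mp (D : set R) (q : R) : measurable_fun D (fun x : R => (x `^ q)%:E).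
  by apply/measurable_EFinP; apply: measurable_funTS; exact: measurable_powR.
have [] // := @ge0_integrable_le R (outside 0) cos_kernel
   (2 * (1 `^ (2 - 2 * s) / (2 - 2 * s) + 2 * (1 `^ (- (2 * s)) / (2 * s)))).
- exact: measurable_outside.
- exact: measurable_cos_kernel.
- by move=> h _; exact: cos_kernel_ge0.
rewrite ge0_integral_even_outside//; last 3 first.
- exact: measurable_cos_kernel.
- exact: cos_kernel_ge0.
- by move=> h; rewrite /cos_kernel cosN normrN.
rewrite [leRHS]EFinM lee_wpmul2l ?lee_fin// [leRHS]EFinD.
have -> : `]0, +oo[%classic = `]0, 1]%classic `|` `]1, +oo[%classic :> set R.
  apply/seteqP; split => x /=; rewrite !in_itv/= ?andbT.
    by move=> ->/=; case: (leP x 1) => H; [left|right].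
  by move=> [/andP[]//|]; exact: lt_trans.
rewrite ge0_integral_setU//; last 3 first.
- exact: mck.
- by move=> h _; rewrite lee_fin cos_kernel_ge0.
- by apply/disj_setPS => x [] /=; rewrite !in_itv/= andbT => /andP[_ /le_lt_trans h] /h; rewrite ltxx.
apply: leeD.
- apply: le_trans (integral_powR0_le s3 ltr01); apply: ge0_le_integral => //.
  + by move=> h _; rewrite lee_fin cos_kernel_ge0.
  + exact: mck.
  + exact: mp.
  + move=> h /=; rewrite in_itv/= => /andP[h0 _]; rewrite lee_fin /cos_kernel gtr0_norm//.
    have -> : 2 - 2 * s - 1 = 2 + (- (1 + 2 * s)) by ring.
    rewrite powRD; last by rewrite (gt_eqF h0) implybT.
    by rewrite ler_wpM2r ?powR_ge0// powR_mulrn ?(ltW h0)// one_sub_cos_le.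
- rewrite EFinM; apply: (@le_trans _ _ (\int[mu]_(x in `[1%R, +oo[) (2%:E * (x `^ (- (2 * s) - 1))%:E))%E).
    rewrite -integral_itv_obnd_cbnd; last by apply: measurable_funeM; exact: mp.
    apply: ge0_le_integral => //.
    + by move=> h _; rewrite lee_fin cos_kernel_ge0.
    + exact: mck.
    + by apply: measurable_funeM; exact: mp.
    + move=> h /=; rewrite in_itv/= andbT => h1; rewrite -EFinM lee_fin.
      have h0 : 0 < h by exact: lt_trans h1.
      rewrite /cos_kernel gtr0_norm//.
      have -> : - (1 + 2 * s) = - (2 * s) - 1 by ring.
      by rewrite ler_wpM2r ?powR_ge0//; have := cos_geN1 h; lra.
  rewrite ge0_integralZl//; [|exact: mp|by move=> x _; rewrite lee_fin powR_ge0].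
  by rewrite lee_wpmul2l ?lee_fin// integral_powRy_le.
Qed.

Lemma integrable_cos_kernel_outside e : 0 <= e -> mu.-integrable (outside e) (EFin \o cos_kernel).
Proof.
move=> e0; apply: integrableS integrable_cos_kernel.
- exact: measurable_outside.
- exact: measurable_outside.
- by move=> h; rewrite /outside/=; exact: le_lt_trans.
Qed.

Lemma kappa_ge0 e : 0 <= kappa e.
Proof. by apply: Rintegral_ge0 => h _; exact: cos_kernel_ge0. Qed.

Lemma kappa_noninc e f : 0 <= e -> e <= f -> kappa f <= kappa e.
Proof.
move=> e0 ef; have f0 : 0 <= f by exact: le_trans ef.
have ie := integrable_cos_kernel_outside e0.
have iff := integrable_cos_kernel_outside f0.
rewrite /kappa /Rintegral fine_le//.
- by apply: integrable_fin_num => //; exact: measurable_outside.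
- by apply: integrable_fin_num => //; exact: measurable_outside.
- apply: ge0_subset_integral => //.
  + exact: measurable_outside.
  + exact: measurable_outside.
  + by apply/measurable_EFinP; exact: measurable_cos_kernel.
  + by move=> h _; rewrite lee_fin cos_kernel_ge0.
  + by move=> h; rewrite /outside/=; exact: le_lt_trans.
Qed.

Definition kappa0 : R := lim (kappa e @[e --> 0^'+]).

Lemma cvg_kappa : kappa e @[e --> 0^'+] --> kappa0.
Proof.
apply: nonincreasing_at_right_is_cvgr.
- apply: nearW => x a b; rewrite !in_itv/= => /andP[a0 _] _ ba.
  by apply: kappa_noninc => //; exact: ltW.
- apply: nearW => z; exists (kappa 0); apply/ubP => _ [a /= az <-].
  move: az; rewrite in_itv/= => /andP[a0 _].
  by apply: kappa_noninc => //; exact: ltW.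
Qed.

Lemma cvg_kappa_scale (l : R) : 0 < l -> kappa (l * e) @[e --> 0^'+] --> kappa0.
Proof.
move=> l0; apply: (cvg_comp (fun e => l * e) kappa _ cvg_kappa).
move=> P [d /= d0 dP]; exists (d / l); first by rewrite /= divr_gt0.
move=> e /=; rewrite sub0r normrN => ed e0; apply: dP; last by rewrite mulr_gt0.
by rewrite /= sub0r normrN normrM gtr0_norm// mulrC -ltr_pdivlMr.
Qed.

Lemma fl_trunc_shift (u : R -> R) x e : continuous u ->
  fl_trunc s u x e =
  \int[mu]_(h in outside e) ((u x - u (x + h)) * `|h| `^ (- (1 + 2 * s))).
Proof.
move=> cu; rewrite /fl_trunc /Rintegral; congr fine.
rewrite integral_fl_dom_shift; last by apply/measurable_EFinP; exact: measurable_fl_kernel.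
apply: eq_integral => h _; rewrite /fl_kernel opprD addrA subrr sub0r normrN.
by rewrite powRN.
Qed.

Lemma fl_trunc_shiftN (u : R -> R) x e : 0 <= e -> continuous u ->
  fl_trunc s u x e =
  \int[mu]_(h in outside e) ((u x - u (x - h)) * `|h| `^ (- (1 + 2 * s))).
Proof.
move=> e0 cu; rewrite fl_trunc_shift// /Rintegral; congr fine.
rewrite (@integral_measure_preserving _ (-%R) (outside e)).
- congr (integral _ _ _).
    by apply/seteqP; split => h; rewrite /outside/= normrN.
  by apply/funext => h; rewrite normrN.
- exact: oppr_measurable.
- exact: measure_opp.
- exact: measurable_outside.
- apply/measurable_EFinP; apply: measurable_funM; last exact: measurable_powR_norm.
  apply: measurable_funTS; apply: measurable_funB => //.
  apply: (measurableT_comp (continuous_measurable_fun cu)).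
  exact: measurable_funD.
Qed.

Lemma continuous_sin_scale (l : R) : continuous (fun x : R => sin (l * x)).
Proof. by move=> x; exact: is_derive_continuous (is_derive_sin_scale l x). Qed.

(** Averaging over [h] and [-h] removes the odd part of [sin (l (x + h))], and
    scaling [h] by [l] produces the symbol. *)
Lemma fl_trunc_sin (l x e : R) : 0 < l -> 0 < e ->
  fl_trunc s (fun z => sin (l * z)) x e = sin (l * x) * (l `^ (2 * s) * kappa (l * e)).
Proof.
move=> l0 e0.
pose u := fun z : R => sin (l * z).
have cu : continuous u by exact: continuous_sin_scale.
have iu (g : R -> R) : measurable_fun setT g -> (forall h, `|g h| <= 2) ->
    mu.-integrable (outside e) (EFin \o (fun h => g h * `|h| `^ (- (1 + 2 * s)))).
  move=> mg g2.
  have ip : mu.-integrable (outside e) (EFin \o (fun h => 2 * `|h| `^ (- (1 + 2 * s)))).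
    apply: integrable_EFinZl; first exact: measurable_outside.
    have [] // := @ge0_integrable_le R (outside e) (fun y => `|y| `^ (- (1 + 2 * s)))
      (2 * (e `^ (- (2 * s)) / (2 * s))).
    - exact: measurable_outside.
    - exact: measurable_powR_norm.
    - exact: integral_outside_powR_le.
  apply: le_integrable ip.
  - exact: measurable_outside.
  - apply/measurable_EFinP; apply: measurable_funM; last exact: measurable_powR_norm.
    exact: measurable_funTS.
  - move=> h _; rewrite /= lee_fin !normrM; apply: ler_pM => //.
    by rewrite (ger0_norm (ler0n _ 2)) g2.
have mshift (c : R) : measurable_fun setT (fun h => u x - u (x + c * h)).
  apply: measurable_funB => //; apply: (measurableT_comp (continuous_measurable_fun cu)).
  by apply: measurable_funD => //; exact: measurable_funM.
have le2 (c : R) (h : R) : `|u x - u (x + c * h)| <= 2.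
  apply: le_trans (ler_normB _ _) _.
  by rewrite -[leRHS](_ : 1 + 1 = _)// lerD// sin_max.
have i1 : mu.-integrable (outside e) (EFin \o (fun h => (u x - u (x + h)) * `|h| `^ (- (1 + 2 * s)))).
  have := iu _ (mshift 1) (le2 1).
  by under eq_fun do rewrite mul1r.
have i2 : mu.-integrable (outside e) (EFin \o (fun h => (u x - u (x - h)) * `|h| `^ (- (1 + 2 * s)))).
  have := iu _ (mshift (-1)) (le2 (-1)).
  by under eq_fun do rewrite mulN1r.
have i3 : mu.-integrable (outside e) (EFin \o (fun h => (1 - cos (l * h)) * `|h| `^ (- (1 + 2 * s)))).
  apply: iu.
    apply: measurable_funB => //; apply: continuous_measurable_fun => z.
    exact: is_derive_continuous (is_derive_cos_scale l z).
  by move=> h; rewrite ger0_norm ?subr_ge0 ?cos_le1//; have := cos_geN1 (l * h); lra.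
have E2 : 2 * fl_trunc s u x e = 2 * (sin (l * x) *
    \int[mu]_(h in outside e) ((1 - cos (l * h)) * `|h| `^ (- (1 + 2 * s)))).
  rewrite mulr_natl mulr2n {1}fl_trunc_shift// fl_trunc_shiftN ?(ltW e0)//.
  rewrite -RintegralD//; last exact: measurable_outside.
  rewrite mulrA -RintegralZl//; last exact: measurable_outside.
  apply: eq_Rintegral => h _; rewrite /u !mulrDr mulrN sinD sinB; ring.
have Es : kappa (l * e) = l `^ (- (2 * s)) *
    \int[mu]_(h in outside e) ((1 - cos (l * h)) * `|h| `^ (- (1 + 2 * s))).
  have E : (\int[mu]_(h in outside (l * e)) (cos_kernel h)%:E = l%:E *
      \int[mu]_(h in outside e) (l `^ (- (1 + 2 * s)) * ((1 - cos (l * h)) * `|h| `^ (- (1 + 2 * s))))%:E)%E.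
    rewrite (@ge0_integral_scale _ l)//; last 3 first.
    - exact: measurable_outside.
    - by apply/measurable_EFinP; exact: measurable_cos_kernel.
    - by move=> h _; rewrite lee_fin cos_kernel_ge0.
    congr (_ * _)%E.
    have -> : (fun h => l * h) @^-1` outside (l * e) = outside e.
      by apply/seteqP; split => h; rewrite /outside/= normrM (gtr0_norm l0) ltr_pM2l.
    apply: eq_integral => h _; congr EFin.
    by rewrite /cos_kernel normrM (gtr0_norm l0) powRM ?(ltW l0)// mulrCA.
  rewrite /kappa {1}/Rintegral E fineM//; last first.
    apply: integrable_fin_num; first exact: measurable_outside.
    by apply: integrable_EFinZl => //; exact: measurable_outside.
  rewrite -/(Rintegral _ _ _) RintegralZl//; last exact: measurable_outside.
  rewrite mulrA; congr (_ * _).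
  have -> : - (1 + 2 * s) = - (2 * s) - 1 by ring.
  rewrite powRB; last by rewrite (gt_eqF l0) implybT.
  by rewrite powRr1 ?(ltW l0)//= mulrCA divff ?mulr1// gt_eqF.
have E1 : fl_trunc s u x e = sin (l * x) *
    \int[mu]_(h in outside e) ((1 - cos (l * h)) * `|h| `^ (- (1 + 2 * s))).
  by apply: (mulfI _ E2).
by rewrite -/u E1 Es powRN mulVKf// powR_eq0 (gt_eqF l0).
Qed.

Section series.
Variables (lam b : nat -> R).
Hypotheses (b0 : forall k, 0 <= b k) (lam0 : forall k, 0 < lam k).
Hypotheses (cb : cvgn (series b)) (cbl : cvgn (series (fun k => b k * lam k `^ (2 * s)))).

(** Away from the diagonal the kernel of a bounded function has the integrable
    majorant [2 M |x - y| ^ - (1 + 2 s)], so the partial sums pass to the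
    limit. *)
Lemma fl_trunc_ssin x e : 0 < e ->
  fl_trunc s (ssin lam b) x e =
  limn (series (fun k => b k * fl_trunc s (fun z => sin (lam k * z)) x e)).
Proof.
move=> e0.
pose phi k := fun z : R => sin (lam k * z).
pose M := limn (series b).
have cphi k : continuous (phi k) by exact: continuous_sin_scale.
have iphi k : mu.-integrable (fl_dom x e) (EFin \o fl_kernel s (phi k) x).
  by apply: (integrable_fl_kernel (M := 1)) => // z; exact: sin_max.
pose F N y := \sum_(0 <= k < N) (b k * fl_kernel s (phi k) x y).
have iF N : mu.-integrable (fl_dom x e) (EFin \o F N) /\
   \int[mu]_(y in fl_dom x e) F N y = series (fun k => b k * fl_trunc s (phi k) x e) N.
  elim: N => [|N [IH1 IH2]].
    rewrite (_ : F 0%N = cst 0); last by apply/funext => y; rewrite /F big_geq.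
    split; first exact: integrable0.
    by rewrite /series/= big_geq// /Rintegral integral0.
  have E : F N.+1 = fun y => F N y + b N * fl_kernel s (phi N) x y.
    by apply/funext => y; rewrite /F big_nat_recr.
  have i2 : mu.-integrable (fl_dom x e) (EFin \o (fun y => b N * fl_kernel s (phi N) x y)).
    by apply: integrable_EFinZl => //; exact: measurable_fl_dom.
  rewrite E; split; first by apply: integrable_EFinD => //; exact: measurable_fl_dom.
  rewrite RintegralD//; last exact: measurable_fl_dom.
  rewrite IH2 seriesSr/= RintegralZl//; exact: measurable_fl_dom.
have FE N y : F N y = (series (fun k => b k * sin (lam k * x)) N - series (fun k => b k * sin (lam k * y)) N)
    * `|x - y| `^ (- (1 + 2 * s)).
  rewrite /F /series/= -sumrB mulr_suml; apply: eq_bigr => k _.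
  by rewrite /fl_kernel /phi powRN; ring.
have sM N z : `|series (fun k => b k * sin (lam k * z)) N| <= M.
  apply: le_trans (ler_norm_sum _ _ _) _; apply: le_trans (ge0_series_lim_ge N b0 cb).
  by apply: ler_sum => k _; exact: ssin_term_le.
have ig := integrable_EFinZl (2 * M) (measurable_fl_dom x e) (integrable_dist_powR x e0).
have Fcvg y : F N y @[N --> \oo] --> fl_kernel s (ssin lam b) x y.
  under eq_fun do rewrite FE.
  rewrite /fl_kernel -powRN; apply: cvgMl; apply: cvgB; exact: cvg_ssin.
have [] := @dominated_convergence _ (measurableTypeR R) R mu (fl_dom x e) (measurable_fl_dom x e)
  (fun N => EFin \o F N) (EFin \o fl_kernel s (ssin lam b) x)
  (EFin \o (fun y => 2 * M * `|x - y| `^ (- (1 + 2 * s)))).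
- by move=> N; exact: (measurable_int _ (iF N).1).
- by apply/measurable_EFinP; apply: measurable_fl_kernel; exact: continuous_ssin.
- by apply: aeW => y _; apply: cvg_EFin; [exact: nearW|exact: Fcvg].
- exact: ig.
- apply: aeW => y N _ /=; rewrite lee_fin FE normrM (ger0_norm (powR_ge0 _ _)).
  rewrite ler_wpM2r ?powR_ge0//; apply: le_trans (ler_normB _ _) _.
  by have := sM N x; have := sM N y; lra.
move=> iA _ cvgI.
have fin : (\int[mu]_(y in fl_dom x e) (fl_kernel s (ssin lam b) x y)%:E)%E \is a fin_num.
  by apply: integrable_fin_num => //; exact: measurable_fl_dom.
have : (fun N => \int[mu]_(y in fl_dom x e) F N y) @ \oo --> fl_trunc s (ssin lam b) x e.
  by apply: fine_cvg; rewrite fineK.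
by under eq_fun do rewrite (iF _).2; move=> /cvg_lim <-.
Qed.

(** The truncated symbols are bounded by [kappa 0], so Tannery's theorem
    applies to the limit [e -> 0] of the series. *)
Lemma cvg_fl_trunc_ssin x :
  fl_trunc s (ssin lam b) x e @[e --> 0^'+] -->
  kappa0 * ssin lam (fun k => b k * lam k `^ (2 * s)) x.
Proof.
have E : {near 0^'+, (fun e => limn (series (fun k => b k * (sin (lam k * x) * (lam k `^ (2 * s) * kappa (lam k * e))))))
    =1 (fun e => fl_trunc s (ssin lam b) x e)}.
  near=> e; rewrite fl_trunc_ssin//; congr (limn (series _)); apply/funext => k.
  by rewrite fl_trunc_sin.
apply: cvg_trans (near_eq_cvg E) _.
have -> : kappa0 * ssin lam (fun k => b k * lam k `^ (2 * s)) x =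
   limn (series (fun k => b k * (sin (lam k * x) * (lam k `^ (2 * s) * kappa0)))).
  rewrite /ssin -lim_series_cmul.
    by congr (limn (series _)); apply/funext => k; ring.
  by apply: cvg_ssin => // k; rewrite mulr_ge0// powR_ge0.
apply: (@tannery _ _ (0^'+) _ (fun k e => b k * (sin (lam k * x) * (lam k `^ (2 * s) * kappa (lam k * e)))) _
  (fun k => kappa 0 * (b k * lam k `^ (2 * s)))).
- exact: cvg_series_cmul.
- near=> e => k.
  rewrite !normrM (ger0_norm (b0 k)) (ger0_norm (powR_ge0 _ _)) (ger0_norm (kappa_ge0 _)).
  rewrite mulrCA [leRHS]mulrC -[leRHS]mul1r; apply: ler_pM; rewrite ?sin_max//.
    by rewrite mulr_ge0// mulr_ge0 ?powR_ge0// kappa_ge0.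
  rewrite mulrA ler_wpM2l ?mulr_ge0 ?powR_ge0// kappa_noninc//.
  by rewrite mulr_ge0// ltW.
- move=> k; apply: cvgMr; apply: cvgMr; apply: cvgMr; exact: cvg_kappa_scale.
Unshelve. all: by end_near. Qed.

Theorem frac_laplacian_ssin x :
  frac_laplacian_defined s (ssin lam b) x /\
  frac_laplacian s (ssin lam b) x =
  c_fl s * kappa0 * ssin lam (fun k => b k * lam k `^ (2 * s)) x.
Proof.
split; last by rewrite /frac_laplacian (cvg_lim _ (@cvg_fl_trunc_ssin x))// mulrA.
split; last by apply/cvg_ex; eexists; exact: cvg_fl_trunc_ssin.
move=> e e0; apply: (integrable_fl_kernel (M := limn (series b))) => //.
- exact: continuous_ssin.
- by move=> z; exact: ssin_le.
Qed.

End series.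

End fractional_laplacian.

(** * Hölder spaces *)

Section hoelder_spaces.
Context {R : realType}.

(** For [0 <= t <= 1] one has [t <= t ^ r]; this is applied to [a / (a + b)]
    and [b / (a + b)], which add up to 1. *)
Lemma powR_subadd (a b r : R) : 0 <= a -> 0 <= b -> 0 < r <= 1 ->
  (a + b) `^ r <= a `^ r + b `^ r.
Proof.
move=> a0 b0 /andP[r0 r1].
have [ab|ab] := eqVneq (a + b) 0.
  by rewrite ab powR0 ?gt_eqF// addr_ge0// powR_ge0.
have ab0 : 0 < a + b by rewrite lt_neqAle eq_sym ab addr_ge0.
have key c : 0 <= c -> c <= a + b -> (a + b) `^ r * (c / (a + b)) <= c `^ r.
  move=> c0 cab; have [->|cn] := eqVneq c 0.
    by rewrite mul0r mulr0 powR_ge0.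
  have cp : 0 < c by rewrite lt_neqAle eq_sym cn.
  have -> : c `^ r = (a + b) `^ r * (c / (a + b)) `^ r.
    rewrite -powRM ?divr_ge0 ?(ltW ab0)//; congr (_ `^ _).
    by rewrite mulrCA divff// mulr1.
  rewrite ler_wpM2l ?powR_ge0//; apply: ger1_powR => //.
  by rewrite divr_gt0//= ler_pdivrMr// mul1r.
have := lerD (key a a0 _) (key b b0 _); rewrite lerDl lerDr => /(_ b0 a0).
by rewrite -mulrDr -mulrDl divff// mulr1.
Qed.

Lemma hoelder_continuous (f : R -> R) (C r : R) : 0 < r ->
  (forall x y, `|f x - f y| <= C * `|x - y| `^ r) -> continuous f.
Proof.
move=> r0 fC x.
have C0 : 0 <= C.
  by have := fC 1 0; rewrite subr0 normr1 powR1 mulr1; exact: le_trans.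
apply/cvgrPdist_lt => e e0.
have C1 : 0 < C + 1 by rewrite ltr_wpDl.
near=> y.
apply: le_lt_trans (fC _ _) _.
apply: (@le_lt_trans _ _ ((C + 1) * `|x - y| `^ r)).
  by rewrite ler_wpM2r ?powR_ge0// lerDl.
rewrite -ltr_pdivlMl// mulrC.
have -> : e / (C + 1) = ((e / (C + 1)) `^ r^-1) `^ r.
  by rewrite -powRrM mulVf ?gt_eqF// powRr1// divr_ge0// ltW.
apply: gt0_ltr_powR; rewrite ?nnegrE ?powR_ge0//.
near: y; apply: (@cvgr_dist_lt _ _ _ _ _ id) => //.
by rewrite powR_gt0// divr_gt0.
Unshelve. all: by end_near. Qed.

Lemma bounded_globally (A : set R) (f : R -> R) (M : R) :
  (forall x, A x -> `|f x| <= M) -> [bounded f x | x in A].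
Proof.
move=> fM; exists M; split; first exact: num_real.
by move=> z Mz x Ax; apply: le_trans (fM x Ax) _; exact: ltW.
Qed.

(** The McShane extension of [v \o u^-1]: a bound on the increments of [v] by
    those of [u] makes [v] a function of [u], Hölder on the range of [u]; the
    infimum of translates extends it with the same constant. *)
Lemma hoelder_factor (u v : R -> R) (M C beta : R) : 0 < beta < 1 ->
  (forall x, `|v x| <= M) -> (forall x y, `|v x - v y| <= C * `|u x - u y| `^ beta) ->
  exists f : R -> R, in_C beta [set: R] f /\ forall x, f (u x) = v x.
Proof.
move=> /andP[b0 b1] vM vC0.
wlog C0 : C vC0 / 0 <= C.
  move=> H; apply: (H `|C|) => // x y; apply: le_trans (vC0 x y) _.
  by rewrite ler_wpM2r ?powR_ge0// ler_norm.
have vC x y : v x <= v y + C * `|u x - u y| `^ beta.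
  by rewrite -lerBlDl; apply: le_trans (vC0 x y); exact: ler_norm.
have M0 : 0 <= M by apply: le_trans (vM 0).
pose E t := [set v x + C * `|t - u x| `^ beta | x in [set: R]].
have Elb t : lbound (E t) (- M).
  move=> _ [x _ <-]; have := vM x; rewrite ler_norml => /andP[h _].
  by apply: le_trans h _; rewrite lerDl mulr_ge0// powR_ge0.
have En t : E t !=set0 by exists (v 0 + C * `|t - u 0| `^ beta), 0.
have Ei t : has_inf (E t) by split; [exact: En|exists (- M); exact: Elb].
pose g t := inf (E t).
have gle t x : g t <= v x + C * `|t - u x| `^ beta.
  by apply: ge_inf; [exists (- M); exact: Elb|exists x].
have gge t z : (forall x, z <= v x + C * `|t - u x| `^ beta) -> z <= g t.
  by move=> H; apply: lb_le_inf => // _ [x _ <-].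
pose f t := Num.min M (g t).
have fu x : f (u x) = v x.
  have -> : f (u x) = g (u x).
    apply/min_idPr; apply: le_trans (gle _ x) _.
    rewrite subrr normr0 powR0 ?gt_eqF// mulr0 addr0.
    by apply: le_trans (vM x); exact: ler_norm.
  apply/eqP; rewrite eq_le; apply/andP; split.
    by apply: le_trans (gle _ x) _; rewrite subrr normr0 powR0 ?gt_eqF// mulr0 addr0.
  by apply: gge => y; exact: vC.
have gL t t' : g t <= g t' + C * `|t - t'| `^ beta.
  rewrite -lerBlDr; apply: gge => x; rewrite lerBlDr.
  apply: le_trans (gle t x) _; rewrite -addrA lerD2l -mulrDr ler_wpM2l// .
  apply: le_trans (powR_subadd _ _ _); rewrite ?normr_ge0 ?b0 ?(ltW b1)//.
  apply: ge0_ler_powR; rewrite ?nnegrE ?addr_ge0 ?(ltW b0)//.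
  have -> : t - u x = (t - t') + (t' - u x) by ring.
  by rewrite [leRHS]addrC; exact: ler_normD.
have fL t t' : f t <= f t' + C * `|t - t'| `^ beta.
  have h0 : 0 <= C * `|t - t'| `^ beta by rewrite mulr_ge0// powR_ge0.
  rewrite /f addr_minl le_min !ge_min lerDl h0 /=; apply/orP; right; exact: gL.
have fN t t' : `|f t - f t'| <= C * `|t - t'| `^ beta.
  apply/ler_normlP; split; last by rewrite lerBlDl; exact: fL.
  by rewrite opprB lerBlDl distrC; exact: fL.
have fM t : `|f t| <= M.
  rewrite ler_norml /f ge_min lexx andbT le_min; apply/andP; split; first lra.
  by apply: lb_le_inf.
exists f; split=> //.
have k0 : Num.truncn beta = 0%N by apply/truncn0Pn; rewrite -ltNge.
rewrite /in_C k0; split.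
- by [].
- move=> i; rewrite leqn0 => /eqP ->; apply: continuous_subspaceT.
  exact: hoelder_continuous fN.
- move=> i; rewrite leqn0 => /eqP ->; exact: bounded_globally.
- by rewrite subr0; exists C => x y _ _; exact: fN.
Qed.

Lemma cvg_diff_quot (A : set R) (g : R -> R) (x d : R) : is_derive x 1 g d ->
  diff_quot g x y @[y --> within A x^'] --> d.
Proof.
move=> /is_derive1_caratheodory[q [gq cq <-]].
apply: cvg_within_filter.
have E : {near x^', q =1 diff_quot g x}.
  near=> y; rewrite /diff_quot gq mulfK// subr_eq0.
  by near: y; exact: nbhs_dnbhs_neq.
apply: cvg_trans (near_eq_cvg E) _.
exact: cvg_within_filter.
Unshelve. all: by end_near. Qed.

Definition no_isolated (A : set R) := forall x, A x -> ProperFilter (within A x^').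

Lemma no_isolatedP (A : set R) :
  (forall x e : R, A x -> 0 < e -> exists y : R, [/\ A y, y != x & `|x - y| < e]) -> no_isolated A.
Proof.
move=> H x Ax; apply: Build_ProperFilter.
move=> [e /= e0 he]; have [y [Ay yx xy]] := H x e Ax e0.
exact: (he y xy yx Ay).
Qed.

Lemma no_isolated_setT : no_isolated [set: R].
Proof.
apply: no_isolatedP => x e _ e0; exists (x + e / 2); split=> //.
  by rewrite -subr_eq0 addrAC subrr add0r gt_eqF// divr_gt0.
by rewrite opprD addrA subrr sub0r normrN gtr0_norm ?divr_gt0//; lra.
Qed.

Lemma no_isolated_itv (r : R) : 0 < r -> no_isolated `[- r, r]%classic.
Proof.
move=> r0; apply: no_isolatedP => x e; rewrite /= in_itv/= => /andP[rx xr] e0.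
pose d := Num.min (e / 2) r.
have d0 : 0 < d by rewrite lt_min divr_gt0.
have de : d < e by apply: (@le_lt_trans _ _ (e / 2)); [rewrite ge_min lexx|lra].
have dr : d <= r by rewrite ge_min lexx orbT.
have [x0|x0] := leP x 0.
  exists (x + d); rewrite /= in_itv/=; split.
  - by apply/andP; split; lra.
  - by rewrite -subr_eq0 addrAC subrr add0r gt_eqF.
  - by rewrite opprD addrA subrr sub0r normrN gtr0_norm.
exists (x - d); rewrite /= in_itv/=; split.
- by apply/andP; split; lra.
- by rewrite -subr_eq0 addrAC subrr add0r oppr_eq0 gt_eqF.
- by rewrite opprB addrCA subrr addr0 gtr0_norm.
Qed.

(** Derivatives relative to [A] are limits along [A], hence unique where [A]
    has no isolated points; there they agree with the ordinary derivatives. *)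
Lemma deriven_on_tower (A : set R) (u : R -> R) (g : nat -> R -> R) k :
  no_isolated A -> (forall x, g 0%N x = u x) ->
  (forall i (x : R), (i < k)%N -> is_derive x 1 (g i) (g i.+1 x)) ->
  (forall i x, (i <= k)%N -> A x -> deriven_on A i u x = g i x) /\
  (forall i, (i < k)%N -> derivable_on A (deriven_on A i u)).
Proof.
move=> nA g0 gd.
have main i : (i <= k)%N -> (forall x, A x -> deriven_on A i u x = g i x) ->
   (i < k)%N -> forall x, A x -> diff_quot (deriven_on A i u) x y @[y --> within A x^'] --> g i.+1 x.
  move=> ik E ik' x Ax.
  have E' : {near within A x^', diff_quot (g i) x =1 diff_quot (deriven_on A i u) x}.
    near=> y; rewrite /diff_quot !E//.
    near: y; exact: withinT.
  apply: cvg_trans (near_eq_cvg E') _.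
  by apply: cvg_diff_quot; exact: gd.
have E i : (i <= k)%N -> forall x, A x -> deriven_on A i u x = g i x.
  elim: i => [|i IH] ik x Ax; first by rewrite g0.
  rewrite [LHS]/= /derive_on; have pf := nA x Ax.
  by apply: cvg_lim => //; apply: main => //; [exact: ltnW|exact: IH (ltnW ik)].
split; first by move=> i x ik; exact: E.
move=> i ik x Ax; apply/cvg_ex; exists (g i.+1 x).
by apply: main => //; [exact: ltnW|exact: E (ltnW ik)].
Unshelve. all: by end_near. Qed.

Lemma in_C_tower (alpha : R) (u : R -> R) (g : nat -> R -> R) :
  let k := Num.truncn alpha in
  (forall x, g 0%N x = u x) ->
  (forall i (x : R), (i < k)%N -> is_derive x 1 (g i) (g i.+1 x)) ->
  (forall i, (i <= k)%N -> continuous (g i)) ->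
  (forall i, (i <= k)%N -> exists M, forall x, `|g i x| <= M) ->
  (exists C, forall x y, `|g k x - g k y| <= C * `|x - y| `^ (alpha - k%:R)) ->
  in_C alpha [set: R] u.
Proof.
move=> k g0 gd gc gb [C gh].
have [E der] := deriven_on_tower no_isolated_setT g0 gd.
have {}E i : (i <= k)%N -> deriven_on [set: R] i u = g i.
  by move=> ik; apply/funext => x; exact: E.
split.
- exact: der.
- by move=> i ik; rewrite E//; apply: continuous_subspaceT; exact: gc.
- by move=> i ik; rewrite E//; have [M gM] := gb i ik; apply: (@bounded_globally _ _ M).
- by rewrite -/k E//; exists C => x y _ _; exact: gh.
Qed.

(** Smoothness of order [alpha + eps] at the origin shows in the derivative of
    order [trunc alpha] alone: it is Hölder with the excess exponent, or
    differentiable when [trunc] jumps. *)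
Lemma in_C_excess (alpha eps r : R) (u : R -> R) (g : nat -> R -> R) :
  let k := Num.truncn alpha in
  0 <= alpha -> 0 < eps -> 0 < r ->
  (forall x, g 0%N x = u x) ->
  (forall i (x : R), (i < k)%N -> is_derive x 1 (g i) (g i.+1 x)) ->
  in_C (alpha + eps) `[- r, r] u ->
  exists C d eta : R, [/\ 0 <= C, alpha - k%:R < d, 0 < eta &
    forall x, 0 < x -> x <= eta -> `|g k x - g k 0| <= C * x `^ d].
Proof.
move=> k alpha0 eps0 r0 g0 gd [der _ _ hol].
have [E _] := deriven_on_tower (no_isolated_itv r0) g0 gd.
have kk' : (k <= Num.truncn (alpha + eps))%N by apply: le_truncn; rewrite lerDl ltW.
have A0 : `[- r, r]%classic (0 : R) by rewrite /= in_itv/= oppr_le0 (ltW r0).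
move: kk'; rewrite leq_eqVlt => /predU1P[kk'|kk'].
  move: hol; rewrite -kk' => -[C holC].
  exists `|C|, (alpha + eps - k%:R), r; split => //.
    by rewrite ltrD2r ltrDl.
  move=> x x0 xr.
  have Ax : `[- r, r]%classic x by rewrite /= in_itv/= xr andbT; lra.
  have := holC x 0 Ax A0; rewrite !E// subr0 (gtr0_norm x0) => /le_trans; apply.
  by rewrite ler_wpM2r ?powR_ge0// ler_norm.
have := der k kk' 0 A0 => /cvg_ex[l cl].
have pf := no_isolated_itv r0 A0.
have /cvgrPdist_lt/(_ _ ltr01) [e /= e0 he] := cl.
exists (`|l| + 1), 1, (Num.min (e / 2) r); split.
- by rewrite addr_ge0.
- by have := truncnS_gt alpha; rewrite -/k -natr1; lra.
- by rewrite lt_min divr_gt0.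
- move=> x x0; rewrite le_min => /andP[xe xr].
  have Ax : `[- r, r]%classic x by rewrite /= in_itv/= xr andbT; lra.
  have xe' : `|0 - x| < e by rewrite sub0r normrN gtr0_norm//; lra.
  have := he x xe' (lt0r_neq0 x0) Ax.
  rewrite /diff_quot !E// subr0 => h.
  rewrite powRr1 ?(ltW x0)// -[x in leRHS](gtr0_norm x0) -ler_pdivrMr ?normr_gt0 ?gt_eqF//.
  rewrite -normf_div.
  have -> : (g k x - g k 0) / x = l - (l - (g k x - g k 0) / x) by ring.
  by apply: le_trans (ler_normB _ _) _; rewrite lerD2l ltW.
Qed.

End hoelder_spaces.

(** * The extremal solution *)

Section solution.
Context {R : realType}.
Variables (s beta m g L : R).
Hypotheses (s0 : 0 < s) (s1 : s < 1) (beta01 : 0 < beta < 1).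
Hypotheses (m0 : 0 < m) (sg : 2 * s < g) (g3 : g < 3) (L0 : 0 < L).

Let w : R := pi / L.
Let lam k : R := w * oddn k.
(** The coefficients of a derivative of order [q] of the series with
    coefficients [mix m g]; [q = 2 s] is the order of the fractional Laplacian
    and [q = - 1] that of a primitive. *)
Let b q k : R := mix m g k * lam k `^ q.

Let w0 : 0 < w. Proof. by rewrite divr_gt0// pi_gt0. Qed.
Let lam0 k : 0 < lam k. Proof. by rewrite mulr_gt0// oddn_gt0. Qed.
Let b0 q k : 0 <= b q k. Proof. by rewrite mulr_ge0 ?powR_ge0// mix_ge0. Qed.
Let g0 : 0 < g. Proof. by apply: lt_trans sg; rewrite mulr_gt0. Qed.

Let bE q k : b q k = w `^ q * mix m (g - q) k.
Proof. by rewrite /b powRM ?(ltW w0) ?(ltW (oddn_gt0 k))// mulrCA mix_powR. Qed.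

Let b_powR q r k : b q k * lam k `^ r = b (q + r) k.
Proof. by rewrite /b -mulrA -powRD//; apply/implyP => _; rewrite gt_eqF. Qed.

Let b_mul q k : b q k * lam k = b (q + 1) k.
Proof. by rewrite -b_powR powRr1// ltW. Qed.

Let b_mulE q : (fun k => b q k * lam k) = b (q + 1).
Proof. by apply/funext => k; exact: b_mul. Qed.

Let cvg_b q : q <= g -> cvgn (series (b q)).
Proof.
move=> qg; have -> : b q = (fun k => w `^ q * mix m (g - q) k).
  by apply/funext => k; exact: bE.
by apply: cvg_series_cmul; apply: cvg_mix => //; rewrite subr_ge0.
Qed.

Let ssin_b q x : q <= g -> ssin lam (b q) x = w `^ q * ssin oddn (mix m (g - q)) (w * x).
Proof.
move=> qg; rewrite /ssin -lim_series_cmul.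
  congr (limn (series _)); apply/funext => k.
  by rewrite bE -mulrA /lam; congr (_ * (_ * sin _)); ring.
by apply: cvg_ssin; [move=> k; exact: mix_ge0|apply: cvg_mix; rewrite ?subr_ge0].
Qed.

Definition extremal : R -> R := ssin lam (b 0).

Let tower i : R -> R :=
  match i with
  | 0%N => extremal
  | 1%N => scos lam (b 1)
  | _ => (fun x => - ssin lam (b 2) x)
  end.

Let k := Num.truncn g.

Let kg : k%:R <= g. Proof. by rewrite truncn_le ltW. Qed.

Let gk : g < k%:R + 1. Proof. by rewrite natr1; exact: truncnS_gt. Qed.

Let k2 : (k <= 2)%N.
Proof. by rewrite -ltnS -(@ltr_nat R); apply: le_lt_trans g3. Qed.

Let is_derive_tower i (x : R) : (i < k)%N -> is_derive x 1 (tower i) (tower i.+1 x).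
Proof.
move=> ik; have ig : i.+1%:R <= g by apply: le_trans kg; rewrite ler_nat.
have lamge j : 0 <= lam j by exact: ltW.
have i2 : (i < 2)%N by exact: leq_trans k2.
move: i i2 ig {ik} => [|[|//]] _ ig.
  have e1 : scos lam (b 1) = scos lam (b (0 + 1)) by rewrite add0r.
  rewrite /= /extremal e1 -b_mulE; apply: is_derive_ssin => //; first exact/cvg_b/ltW.
  by rewrite b_mulE add0r; exact: cvg_b.
have -> : tower 2 = (fun x => - ssin lam (b (1 + 1)) x) by [].
rewrite /= -b_mulE; apply: is_derive_scos => //.
  by apply: cvg_b; apply: le_trans ig; rewrite (ler_nat R 1 2).
by rewrite b_mulE; apply: cvg_b.
Qed.

Lemma in_C_extremal : in_C g [set: R] extremal.
Proof.
have ig i : (i <= k)%N -> i%:R <= g.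
  by move=> ik; apply: le_trans kg; rewrite ler_nat.
apply: (@in_C_tower _ _ _ tower) => //.
- move=> i ik; move: i {ik} (leq_trans ik k2) (ig i ik) => [|[|[|//]]] _ qg x.
  + by apply: continuous_ssin => //; exact: cvg_b.
  + by apply: continuous_scos => //; exact: cvg_b.
  + by apply: continuousN; apply: continuous_ssin => //; exact: cvg_b.
- move=> i ik; move: i {ik} (leq_trans ik k2) (ig i ik) => [|[|[|//]]] _ qg.
  + by exists (limn (series (b 0))) => x; apply: ssin_le => //; exact: cvg_b.
  + by exists (limn (series (b 1))) => x; apply: scos_le => //; exact: cvg_b.
  + by exists (limn (series (b 2))) => x; rewrite normrN; apply: ssin_le => //; exact: cvg_b.
- rewrite -/k; exists (2 * limn (series (b g))) => x y.
  have E q : (fun j => b q j * lam j `^ (g - q)) = b g.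
    by apply/funext => j; rewrite b_powR; congr (b _ j); ring.
  have th : 0 <= g - k%:R <= 1.
    by apply/andP; split; [rewrite subr_ge0|rewrite lerBlDl ltW].
  have cg : cvgn (series (b g)) by exact: cvg_b.
  have ck : cvgn (series (b k%:R)) by exact: cvg_b.
  move: th ck; move: (k2); case: (k) => [|[|[|//]]] _ th ck.
  + rewrite mulr0n in th ck *.
    by have := ssin_holder (b0 0) lam0 th ck; rewrite E => /(_ cg x y); exact.
  + by have := scos_holder (b0 1) lam0 th ck; rewrite E => /(_ cg x y); exact.
  + by rewrite -opprD normrN; have := ssin_holder (b0 2) lam0 th ck; rewrite E => /(_ cg x y); exact.
Qed.

Lemma periodic_extremal : periodic extremal (2 * L).
Proof.
move=> x; rewrite /extremal /ssin; congr (limn (series _)); apply/funext => j.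
have -> : lam j * (x + 2 * L) = lam j * x + pi *+ 2 *+ j.*2.+1.
  rewrite mulrDr; congr (_ + _); rewrite /lam /w /oddn -[RHS]mulr_natr -[pi *+ 2]mulr_natr.
  by field; rewrite gt_eqF.
by rewrite (periodicn (@sinD2pi R)).
Qed.

(** The coefficients exceed a multiple of [oddn k ^ (-1 - p)] for [p > g - q]
    as close to [g - q] as one likes, so the oscillation between 0 and [1 /
    lam K] is at least of order [p < d]. *)
Let scos_b_oscillation (q C d eta : R) : q <= g -> g - q < d -> 0 < eta ->
  ~ (forall x : R, 0 < x -> x <= eta -> scos lam (b q) 0 - scos lam (b q) x <= C * x `^ d).
Proof.
move=> qg qd eta0 H.
have dq : 0 < d - (g - q) by rewrite subr_gt0.
have [j ej] : exists j, mixe m j < d - (g - q).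
  have : mixe m j @[j --> \oo] --> 0.
    rewrite -[0](mulr0 m); apply: cvgMr; apply: cvg_expr.
    by rewrite ger0_norm ?invr_ge0// invf_lt1// ltr1n.
  move=> /cvgrPdist_lt/(_ _ dq)[j _ /(_ j (leqnn j))].
  by rewrite /= sub0r normrN gtr0_norm ?mixe_gt0//; exists j.
set p := g - q + mixe m j.
have p0 : 0 <= p by rewrite addr_ge0 ?subr_ge0// ltW// mixe_gt0.
have pd : 0 < d - p by rewrite /p; lra.
have c0 : 0 < w `^ q * mixw j by rewrite mulr_gt0 ?powR_gt0// mixw_gt0.
have cb : forall i, w `^ q * mixw j * oddn i `^ (-1 - p) <= b q i.
  by move=> i; rewrite bE -mulrA ler_pM2l ?powR_gt0//; exact: mix_ge.
have [c' c'0 osc] := scos_oscillation_ge w0 c0 p0 (b0 q) (cvg_b qg) cb.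
have C1 : 0 < `|C| + 1 by rewrite ltr_wpDl.
set D := Num.min eta ((c' / (`|C| + 1)) `^ (d - p)^-1).
have D0 : 0 < D by rewrite lt_min eta0 powR_gt0// divr_gt0.
(* The choice of K makes x = 1 / lam K smaller than eta and so small that
   C * x ^ (d - p) is below c'. *)
pose K := Num.truncn (D^-1 / w).
have lamK : (lam K)^-1 < D.
  rewrite -[D]invrK ltf_pV2 ?posrE ?invr_gt0// -ltr_pdivrMl// mulrC.
  apply: lt_le_trans (truncnS_gt _) _; by rewrite ler_nat -/K ltnS -addnn leq_addr.
have x0 : 0 < (lam K)^-1 by rewrite invr_gt0.
have := H _ x0; have -> : (lam K)^-1 <= eta.
  by apply: le_trans (ltW lamK) _; rewrite ge_min lexx.
move=> /(_ isT); have := osc K; rewrite -/(lam K); set x := (lam K)^-1 in x0 lamK *.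
move=> /le_trans h /h{h}.
have -> : x `^ d = x `^ (d - p) * x `^ p.
  by rewrite -powRD ?subrK// (gt_eqF x0) implybT.
rewrite mulrA ler_pM2r ?powR_gt0// leNgt => /negP; apply.
apply: (@le_lt_trans _ _ (`|C| * x `^ (d - p))).
  by rewrite ler_wpM2r ?powR_ge0// ler_norm.
apply: (@le_lt_trans _ _ (`|C| * (c' / (`|C| + 1)))).
  rewrite ler_wpM2l//.
  have -> : c' / (`|C| + 1) = ((c' / (`|C| + 1)) `^ (d - p)^-1) `^ (d - p).
    by rewrite -powRrM mulVf ?gt_eqF// powRr1// divr_ge0// ltW.
  apply: ge0_ler_powR; rewrite ?nnegrE ?powR_ge0 ?(ltW pd) ?(ltW x0)//.
  by apply: le_trans (ltW lamK) _; rewrite ge_min lexx orbT.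
by rewrite mulrA ltr_pdivrMr// mulrC ltr_pM2l// ltrDl.
Qed.

Let scos_b_le (q C d eta : R) : q + 1 <= g ->
  (forall x : R, 0 < x -> x <= eta -> `|ssin lam (b (q + 1)) x| <= C * x `^ d) -> 0 <= C -> 0 <= d ->
  forall x : R, 0 < x -> x <= eta -> scos lam (b q) 0 - scos lam (b q) x <= C * x `^ (1 + d).
Proof.
move=> qg H C0 d0 x x0 xe.
have dF (y : R) : is_derive y 1 (scos lam (b q)) (- ssin lam (b (q + 1)) y).
  rewrite -b_mulE; apply: is_derive_scos => //.
  - by apply: cvg_b; apply: le_trans qg; rewrite lerDl.
  - by move=> i; exact: ltW.
  - by rewrite b_mulE; exact: cvg_b.
have [|c] := @MVT_segment R (scos lam (b q)) (fun y => - ssin lam (b (q + 1)) y) 0 x (ltW x0) (fun z _ => dF z).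
  apply: continuous_subspaceT => y; apply: continuous_scos => //.
  by apply: cvg_b; apply: le_trans qg; rewrite lerDl.
rewrite in_itv/= => /andP[c0 cx] E.
rewrite -opprB E subr0 mulNr opprK powRD; last by rewrite (gt_eqF x0) implybT.
rewrite powRr1 ?(ltW x0)// [x * _]mulrC mulrA ler_wpM2r ?(ltW x0)//.
move: c0; rewrite le_eqVlt => /predU1P[<-|c0]; first by rewrite ssin0 mulr_ge0// powR_ge0.
apply: le_trans (ler_norm _) _; apply: le_trans (H c c0 (le_trans cx xe)) _.
by rewrite ler_wpM2l// ge0_ler_powR// nnegrE ltW.
Qed.

(** Extra smoothness at the origin makes an increment of order [x ^ d] in the
    top derivative. When it is a sine series, integration turns it into a
    cosine series, whose increments at 0 add up with a single sign. *)
Lemma not_in_C_extremal eps rho : 0 < eps -> 0 < rho ->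
  ~ in_C (g + eps) `[- rho, rho] extremal.
Proof.
move=> eps0 rho0 /(@in_C_excess _ _ _ _ _ tower) H.
have [C [d [eta [C0 gd eta0]]]] := H (ltW g0) eps0 rho0 (fun=> erefl) is_derive_tower.
have d0 : 0 <= d by apply: le_trans (ltW gd); rewrite subr_ge0.
rewrite -/k in gd *; move: gd (kg); move: (k2); case: (k) => [|[|[|//]]] _ gd kg' D.
(* g < 1: a primitive of the sine series is a cosine series. *)
- apply: (@scos_b_oscillation (-1) C (1 + d) eta) => //.
    lra.
    by rewrite mulr0n in gd; lra.
  apply: scos_b_le => //.
    by rewrite addNr.
  move=> x x0 xe; have := D x x0 xe; rewrite /= /extremal ssin0 subr0.
  by rewrite addNr.
(* 1 <= g < 2: the first derivative is already a cosine series. *)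
- apply: (@scos_b_oscillation 1 C d eta) => // x x0 xe.
  by apply: le_trans (D x x0 xe); rewrite distrC; exact: ler_norm.
(* 2 <= g: the second derivative is minus a sine series. *)
- apply: (@scos_b_oscillation 1 C (1 + d) eta) => //.
    lra.
    lra.
  have e2 : 1 + 1 = 2 :> R by [].
  apply: scos_b_le => //; rewrite e2 // => x x0 xe.
  by have := D x x0 xe; rewrite /= ssin0 oppr0 subr0 normrN.
Qed.

Hypothesis increments : exists2 C : R, 0 <= C & forall x y, sin y <= sin x ->
  ssin oddn (mix m (g - 2 * s)) x - ssin oddn (mix m (g - 2 * s)) y <=
  C * (ssin oddn (mix m g) x - ssin oddn (mix m g) y) `^ beta.

(** The fractional Laplacian of the series is a multiple of [ssin lam (b (2 *
    s))]; the bound on increments makes it a Hölder function of the series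
    itself. *)
Lemma solves_extremal :
  exists f : R -> R, in_C beta [set: R] f /\ solves_frac_eq s extremal f.
Proof.
have [C C0 incr] := increments.
have s2 : 2 * s <= g by exact: ltW.
pose W := ssin oddn (mix m (g - 2 * s)).
pose U := ssin oddn (mix m g).
have uE x : extremal x = U (w * x).
  by rewrite /extremal ssin_b ?ltW// powRr0 mul1r subr0.
pose A := c_fl s * kappa0 s * w `^ (2 * s).
pose v x := A * W (w * x).
have lap x : frac_laplacian_defined s extremal x /\ frac_laplacian s extremal x = v x.
  have c0 : cvgn (series (b 0)) by exact/cvg_b/ltW.
  have E : (fun j => b 0 j * lam j `^ (2 * s)) = b (2 * s).
    by apply/funext => j; rewrite b_powR add0r.
  have := frac_laplacian_ssin s0 s1 (b0 0) lam0 c0.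
  rewrite E => /(_ (cvg_b s2) x)[? ->]; split=> //.
  by rewrite ssin_b// /v /A mulrA.
have vM x : `|v x| <= `|A| * limn (series (mix m (g - 2 * s))).
  rewrite /v normrM ler_wpM2l//; apply: ssin_le; first by move=> j; exact: mix_ge0.
  by apply: cvg_mix => //; rewrite subr_ge0.
have WU x y : `|W x - W y| <= C * `|U x - U y| `^ beta.
  wlog yx : x y / sin y <= sin x.
    move=> H; have [yx|/ltW xy] := leP (sin y) (sin x); first exact: H.
    by rewrite distrC [`|U x - _|]distrC; exact: H.
  have W0 : 0 <= W x - W y.
    by rewrite subr_ge0; apply: ssin_mix_mono => //; rewrite subr_gt0.
  have U0 : 0 <= U x - U y by rewrite subr_ge0; exact: ssin_mix_mono.
  by rewrite !ger0_norm//; exact: incr.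
have vu x y : `|v x - v y| <= (`|A| * C) * `|extremal x - extremal y| `^ beta.
  by rewrite /v -mulrBr normrM -mulrA !uE; apply: ler_wpM2l.
have [f [fC fu]] := hoelder_factor beta01 vM vu.
by exists f; split=> // x; have [? ->] := lap x.
Qed.

End solution.

(** For [g = 2 s / (1 - beta)] the ratio [(g - 2 s) / g] of the two exponents
    is [beta]. *)
Lemma increments_interpolation {R : realType} (s beta m : R) :
  0 < s -> 0 < beta < 1 -> 0 < m ->
  exists2 C : R, 0 <= C & forall x y, sin y <= sin x ->
    ssin oddn (mix m (2 * s / (1 - beta) - 2 * s)) x -
    ssin oddn (mix m (2 * s / (1 - beta) - 2 * s)) y <=
    C * (ssin oddn (mix m (2 * s / (1 - beta))) x -
         ssin oddn (mix m (2 * s / (1 - beta))) y) `^ beta.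
Proof.
move=> s0 /andP[b0 b1] m0; set g := 2 * s / (1 - beta).
have B0 : 0 < 1 - beta by rewrite subr_gt0.
have g0 : 0 < g by rewrite divr_gt0// mulr_gt0.
have E : g - 2 * s = beta * g by rewrite /g; field; rewrite gt_eqF.
have p'0 : 0 < g - 2 * s by rewrite E mulr_gt0.
have p'g : g - 2 * s <= g by rewrite gerBl mulr_ge0// ltW.
have := ssin_mix_sub_interpolation m0 p'0 p'g.
by rewrite [X in (X / g)]E mulfK// gt_eqF.
Qed.

(** Between the two series stands [sin x]: it increases at most linearly in
    terms of the smoother one, and the rougher one is Hölder of order [beta]
    in it. *)
Lemma increments_lipschitz {R : realType} (s beta m : R) :
  0 < s -> 0 < beta -> 0 < m -> m <= 1 -> beta + m < 1 ->
  exists2 C : R, 0 <= C & forall x y, sin y <= sin x ->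
    ssin oddn (mix m (2 * s + beta - 2 * s)) x -
    ssin oddn (mix m (2 * s + beta - 2 * s)) y <=
    C * (ssin oddn (mix m (2 * s + beta)) x -
         ssin oddn (mix m (2 * s + beta)) y) `^ beta.
Proof.
move=> s0 b0 m0 m1 bm.
have -> : 2 * s + beta - 2 * s = beta by ring.
set g := 2 * s + beta.
have g0 : 0 < g by rewrite addr_gt0// mulr_gt0.
set A := 4 * (pi / 2 / beta + (1 - (beta + m))^-1) / (expR (- 2) / 2).
have A0 : 0 <= A.
  rewrite divr_ge0 ?divr_ge0 ?expR_ge0// mulr_ge0// addr_ge0 ?invr_ge0 ?subr_ge0 ?(ltW bm)//.
  by rewrite !divr_ge0 ?pi_ge0 ?(ltW b0).
set c := expR (- 2) / 10 / Gamma (g + m).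
have c0 : 0 < c by rewrite !divr_gt0 ?expR_gt0 ?Gamma_gt0// addr_gt0.
exists (A * c^-1 `^ beta); first by rewrite mulr_ge0// powR_ge0.
move=> x y yx; have h := ssin_mix_sub_lower m0 yx g0.
have d0 : 0 <= sin x - sin y by rewrite subr_ge0.
have U0 : 0 <= ssin oddn (mix m g) x - ssin oddn (mix m g) y.
  by apply: le_trans h; rewrite mulr_ge0// ltW.
apply: le_trans (ssin_mix_sub_holder m0 m1 yx b0 bm) _.
rewrite -/A -mulrA ler_wpM2l// -powRM ?invr_ge0 ?(ltW c0)//.
rewrite ge0_ler_powR ?nnegrE ?mulr_ge0 ?invr_ge0 ?(ltW c0) ?(ltW b0)//.
by rewrite ler_pdivlMl.
Qed.

Unset Implicit Arguments.

Theorem theorem1p2 (R : realType) (s beta L : R)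
    (hs0 : 0 < s) (hs1 : s < 1) (hb0 : 0 < beta) (hb1 : beta < 1)
    (hL : 0 < L) :
  (2 * s <= 1 - beta ->
   exists u : R -> R,
     [/\ in_C (2 * s / (1 - beta)) [set: R] u,
         periodic u (2 * L),
         exists f : R -> R, in_C beta [set: R] f /\ solves_frac_eq s u f
       & forall eps rho : R, 0 < eps -> 0 < rho ->
           ~ in_C (2 * s / (1 - beta) + eps) `[- rho, rho] u])
  /\
  (1 - beta < 2 * s ->
   exists u : R -> R,
     [/\ in_C (2 * s + beta) [set: R] u,
         periodic u (2 * L),
         exists f : R -> R, in_C beta [set: R] f /\ solves_frac_eq s u f
       & forall eps rho : R, 0 < eps -> 0 < rho ->
           ~ in_C (2 * s + beta + eps) `[- rho, rho] u]).
Proof.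
have b01 : 0 < beta < 1 by rewrite hb0.
have B0 : 0 < 1 - beta by rewrite subr_gt0.
(* With this m the exponents beta + mixe m j stay away from 1. *)
set m := (1 - beta) / 2.
have m0 : 0 < m by rewrite divr_gt0.
have s20 : 0 < 2 * s by rewrite mulr_gt0.
have sol g : 2 * s < g -> g < 3 ->
    (exists2 C : R, 0 <= C & forall x y, sin y <= sin x ->
      ssin oddn (mix m (g - 2 * s)) x - ssin oddn (mix m (g - 2 * s)) y <=
      C * (ssin oddn (mix m g) x - ssin oddn (mix m g) y) `^ beta) ->
    exists u : R -> R,
      [/\ in_C g [set: R] u, periodic u (2 * L),
         exists f : R -> R, in_C beta [set: R] f /\ solves_frac_eq s u f
       & forall eps rho : R, 0 < eps -> 0 < rho ->
           ~ in_C (g + eps) `[- rho, rho] u].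
  move=> sg g3 incr; exists (extremal m g L); split.
  - exact: in_C_extremal hs0 m0 sg g3 hL.
  - exact: periodic_extremal hL.
  - exact: solves_extremal hs0 hs1 b01 m0 sg hL incr.
  - by move=> eps rho; exact: not_in_C_extremal hs0 m0 sg g3 hL eps rho.
split=> sb.
- apply: sol.
  + by rewrite ltr_pdivlMr// gtr_pMr//; lra.
  + by rewrite ltr_pdivrMr//; lra.
  + exact: increments_interpolation.
- apply: sol.
  + by rewrite ltrDl.
  + lra.
  + by apply: increments_lipschitz => //; rewrite /m; lra.
Qed.
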